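(* Let $n\ge5$, let $F$ be an infinite field whose characteristic does not divide $n$, and let $K=F[\varepsilon]$ where $\varepsilon$ is a primitive $n$-th root of $1$. Let $p\in K\langle x_1,\dots,x_m\rangle$ be a multilinear polynomial which, evaluated on $M_n(K)$, is neither a polynomial identity nor central. Then the Zariski closure of $\operatorname{Im} p$ in $M_n(K)$ has dimension at least $n^2-n+3$.
   Context: A polynomial is multilinear if it has the form $\sum_{\sigma\in S_m}c_\sigma x_{\sigma(1)}\cdots x_{\sigma(m)}$. A polynomial identity has only zero values; a central polynomial has only scalar values and is not a polynomial identity. *)

(* Defs.v *)
From HB Require Import structures.
From mathcomp Require Import all_boot all_order all_algebra all_fingroup all_field.
Set Implicit Arguments. Unset Strict Implicit. Unset Printing Implicit Defensive.
Import GRing.Theory.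
Local Open Scope ring_scope.

Section Defs.
Variables (K : fieldType) (n : nat).

Inductive polyfun : ('M[K]_n -> K) -> Prop :=
| pf_const (c : K) : polyfun (fun _ => c)
| pf_coord (i j : 'I_n) : polyfun (fun A => A i j)
| pf_add f g : polyfun f -> polyfun g -> polyfun (fun A => f A + g A)
| pf_mul f g : polyfun f -> polyfun g -> polyfun (fun A => f A * g A).

Definition zclosed (V : 'M[K]_n -> Prop) : Prop :=
  exists S : ('M[K]_n -> K) -> Prop,
    (forall f, S f -> polyfun f) /\
    (forall A, V A <-> (forall f, S f -> f A = 0)).

Definition zsubset (X Y : 'M[K]_n -> Prop) : Prop := forall A, X A -> Y A.

Definition zclosure (X : 'M[K]_n -> Prop) : 'M[K]_n -> Prop :=
  fun A => forall V, zclosed V -> zsubset X V -> V A.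

Definition zirreducible (Z : 'M[K]_n -> Prop) : Prop :=
  [/\ zclosed Z, (exists A, Z A) &
      forall V W, zclosed V -> zclosed W ->
        zsubset Z (fun A => V A \/ W A) -> zsubset Z V \/ zsubset Z W].

Definition zdim_ge (Y : 'M[K]_n -> Prop) (d : nat) : Prop :=
  exists Z : nat -> ('M[K]_n -> Prop),
    [/\ forall i, (i <= d)%N -> zirreducible (Z i),
        forall i, (i < d)%N ->
          zsubset (Z i) (Z i.+1) /\ exists A, Z i.+1 A /\ ~ Z i A
      & zsubset (Z d) Y].

(** Multilinear polynomial p = sum_{s in S_m} c_s x_{s(1)} ... x_{s(m)},
    given by its coefficient function c, evaluated on matrices. *)
Definition mlin_eval (m : nat) (c : {perm 'I_m} -> K) (a : 'I_m -> 'M[K]_n)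
  : 'M[K]_n :=
  \sum_(s : {perm 'I_m}) c s *: foldr (fun i acc => a (s i) *m acc) 1%:M (enum 'I_m).

Definition mlin_image (m : nat) (c : {perm 'I_m} -> K) : 'M[K]_n -> Prop :=
  fun A => exists a : 'I_m -> 'M[K]_n, A = mlin_eval c a.

Definition is_PI (m : nat) (c : {perm 'I_m} -> K) : Prop :=
  forall a, mlin_eval c a = 0.

Definition is_central (m : nat) (c : {perm 'I_m} -> K) : Prop :=
  (forall a, exists k : K, mlin_eval c a = k%:M) /\ ~ is_PI c.

End Defs.

(* Main.v *)
Require Import Defs.
From HB Require Import structures.
From mathcomp Require Import all_boot all_order all_algebra all_fingroup all_field.
From mathcomp Require Import ring zify.
From Stdlib Require Import Classical FunctionalExtensionality.
Import GRing.Theory.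
Local Open Scope ring_scope.
Set Implicit Arguments. Unset Strict Implicit. Unset Printing Implicit Defensive.

(** The closure of the image has dimension at least the rank of the
    differential of [p] at any point [a]: the closures of the images of the
    affine spaces [a + <v_0, ..., v_{s-1}>], with [v_0, v_1, ...] mapped to
    independent tangent vectors, form a strictly increasing chain of
    irreducible closed sets.

    Some evaluation of [p] on matrix units is a nonscalar diagonal matrix.
    Conjugating by a permutation matrix, its diagonal [d] may be arranged on
    Z/n so that it has no period and satisfies no linear recurrence of order 2;
    this is where [5 <= n] is used.  Grade the matrices by [deg e_ij = j - i]
    in Z/n and restrict [p] to the homogeneous components containing these
    units.  The restriction takes diagonal values, among them all cyclic shifts
    of [d].  Absence of periods makes a generic value [A] have distinct
    eigenvalues, so that the tangent space contains [[A, M_n]], that is, all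
    off-diagonal matrices.  Absence of recurrences means that the values do not
    lie in a plane, and a multilinear map whose values do not lie in a plane
    has three independent partial values at a generic point.  This gives
    [n^2 - n + 3] independent tangent vectors. *)

(** * Functions that are polynomial on lines *)

Definition infinite_type (T : eqType) := forall s : seq T, exists x : T, x \notin s.

Lemma infinite_uniq_seq (T : eqType) (N : nat) :
  infinite_type T -> exists s : seq T, uniq s /\ size s = N.
Proof.
move=> Tinf; elim: N => [|N [s [us ss]]]; first by exists [::].
by have [x xs] := Tinf s; exists (x :: s); rewrite /= xs us ss.
Qed.

Lemma infinite_inj (T U : eqType) (f : T -> U) :
  injective f -> infinite_type T -> infinite_type U.
Proof.
move=> finj Tinf s.
have [t [ut st]] := infinite_uniq_seq (size s).+1 Tinf.
have: ~~ all [in s] (map f t).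
  apply/negP => /allP sub.
  have := uniq_leq_size (_ : uniq (map f t)) sub.
  by rewrite map_inj_uniq // size_map st ltnn => /(_ ut).
by case/allPn => x _ xs; exists x.
Qed.

Section LinePoly.
Variable K : fieldType.
Hypothesis Kinf : infinite_type K.

Lemma poly_neq0_horner (q : {poly K}) : q != 0 -> exists t, q.[t] != 0.
Proof.
move=> q0; have [s [us ss]] := infinite_uniq_seq (size q) Kinf.
have: ~~ all (root q) s.
  by apply/negP => /(max_poly_roots q0) /(_ us); rewrite ss ltnn.
by case/allPn => t _ qt; exists t.
Qed.

Lemma horner_eq0 (q : {poly K}) : (forall t, q.[t] = 0) -> q = 0.
Proof.
move=> q0; apply/eqP/negPn/negP => /poly_neq0_horner [t].
by rewrite q0 eqxx.
Qed.

Section OneSpace.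
Variable E : lmodType K.
Implicit Types (g : E -> K) (d : nat).

(** Polynomial behaviour is recorded only along lines, which needs no coordinates on [E]. *)
Definition lpoly d g := forall a b, exists q : {poly K},
  (size q <= d.+1)%N /\ forall t, g (a + t *: b) = q.[t].

Lemma lpoly_weaken d e g : (d <= e)%N -> lpoly d g -> lpoly e g.
Proof.
move=> de gP a b; have [q [sq qE]] := gP a b.
by exists q; split=> //; apply: leq_trans sq _.
Qed.

Lemma lpoly_ext d g h : g =1 h -> lpoly d g -> lpoly d h.
Proof.
move=> gh gP a b; have [q [sq qE]] := gP a b.
by exists q; split=> // t; rewrite -gh.
Qed.

Lemma lpoly_const d (k : K) : lpoly d (fun=> k).
Proof.
move=> a b; exists k%:P; split; last by move=> t; rewrite hornerC.
by rewrite (leq_trans (size_polyC_leq1 _)).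
Qed.

Lemma lpoly_add d g h : lpoly d g -> lpoly d h -> lpoly d (fun x => g x + h x).
Proof.
move=> gP hP a b; have [q [sq qE]] := gP a b; have [r [sr rE]] := hP a b.
exists (q + r); split; last by move=> t; rewrite hornerD qE rE.
by rewrite (leq_trans (size_polyD _ _)) // geq_max sq sr.
Qed.

Lemma lpoly_mul d e g h :
  lpoly d g -> lpoly e h -> lpoly (d + e) (fun x => g x * h x).
Proof.
move=> gP hP a b; have [q [sq qE]] := gP a b; have [r [sr rE]] := hP a b.
exists (q * r); split; last by move=> t; rewrite hornerM qE rE.
by rewrite (leq_trans (size_polyMleq _ _)) //; lia.
Qed.

Lemma lpoly_scale d k g : lpoly d g -> lpoly d (fun x => k * g x).
Proof. exact: (@lpoly_mul 0 d _ _ (lpoly_const 0 k)). Qed.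

Lemma lpoly_sum (I : Type) (r : seq I) (P : pred I) d (g : I -> E -> K) :
  (forall i, lpoly d (g i)) -> lpoly d (fun x => \sum_(i <- r | P i) g i x).
Proof.
move=> gP; elim: r => [|i r IH].
  by apply: lpoly_ext (lpoly_const d 0) => x; rewrite big_nil.
have [Pi|Pi] := boolP (P i); last first.
  by apply: lpoly_ext IH => x; rewrite big_cons (negbTE Pi).
by apply: lpoly_ext (lpoly_add (gP i) IH) => x; rewrite big_cons Pi.
Qed.

Lemma lpoly_prod (I : Type) (r : seq I) (d : I -> nat) (g : I -> E -> K) :
  (forall i, lpoly (d i) (g i)) ->
  lpoly (\sum_(i <- r) d i) (fun x => \prod_(i <- r) g i x).
Proof.
move=> gP; elim: r => [|i r IH].
  by apply: lpoly_ext (lpoly_const _ 1) => x; rewrite big_nil.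
rewrite big_cons; apply: lpoly_ext (lpoly_mul (gP i) IH) => x.
by rewrite big_cons.
Qed.

Lemma lpoly_exp d g k : lpoly d g -> lpoly (k * d) (fun x => g x ^+ k).
Proof.
move=> gP; elim: k => [|k IH]; first exact: lpoly_const.
by apply: lpoly_ext (lpoly_mul gP IH) => x; rewrite exprS.
Qed.

Lemma lpoly_det N d (M : E -> 'M[K]_N) :
  (forall i j, lpoly d (fun x => M x i j)) ->
  lpoly (N * d) (fun x => \det (M x)).
Proof.
move=> MP; rewrite /determinant; apply: lpoly_sum => s; apply: lpoly_scale.
have := @lpoly_prod _ (index_enum 'I_N) (fun=> d) _ (fun i => MP i (s i)).
by rewrite sum_nat_const card_ord.
Qed.

(** On the line through [a] and [b] both functions are nonzero polynomials, as seen at [t = 0] and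
    [t = 1]; their product has a nonroot in the infinite field. *)
Lemma lpoly_line_neq0 d e g h a b : lpoly d g -> lpoly e h ->
  g a != 0 -> h b != 0 ->
  exists t, g (a + t *: (b - a)) != 0 /\ h (a + t *: (b - a)) != 0.
Proof.
move=> gP hP ga hb.
have [q [_ qE]] := gP a (b - a); have [r [_ rE]] := hP a (b - a).
have q0 : q != 0.
  by apply: contraNneq ga => q0; rewrite -[a]addr0 -(scale0r (b - a)) qE q0 horner0.
have r0 : r != 0.
  apply: contraNneq hb => r0; have := rE 1.
  by rewrite scale1r addrC subrK r0 horner0 => ->.
have [|t] := @poly_neq0_horner (q * r); first by rewrite mulf_neq0.
by rewrite hornerM mulf_eq0 negb_or -qE -rE => /andP[]; exists t.
Qed.

Lemma lpoly_line_eq0 d e g h a b : lpoly d g -> lpoly e h ->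
  g a != 0 -> (forall t, g (a + t *: b) != 0 -> h (a + t *: b) = 0) ->
  forall t, h (a + t *: b) = 0.
Proof.
move=> gP hP ga gh t.
have [q [_ qE]] := gP a b; have [r [_ rE]] := hP a b.
have q0 : q != 0.
  by apply: contraNneq ga => q0; rewrite -[a]addr0 -(scale0r b) qE q0 horner0.
suff /eqP : q * r = 0 by rewrite mulf_eq0 (negbTE q0) rE => /eqP ->; rewrite horner0.
apply: horner_eq0 => u; rewrite hornerM -qE -rE.
by have [->|/gh ->] := eqVneq (g (a + u *: b)) 0; rewrite ?mul0r ?mulr0.
Qed.

(** A point good for the earlier functions is joined by a line to a point good for the next one. *)
Lemma lpoly_prod_neq0 (I : eqType) (r : seq I) (d : I -> nat) (g : I -> E -> K) :
  (forall i, lpoly (d i) (g i)) -> (forall i, i \in r -> exists a, g i a != 0) ->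
  exists a, forall i, i \in r -> g i a != 0.
Proof.
move=> gP; elim: r => [|i r IH] ex; first by exists 0.
have [j jr|a aP] := IH; first by apply: ex; rewrite inE jr orbT.
have [b bP] := ex i (mem_head _ _).
have [|t [t1 t2]] := lpoly_line_neq0 (lpoly_prod r gP) (gP i) (a := a) _ bP.
  by rewrite prodf_seq_neq0; apply/allP => j /aP.
exists (a + t *: (b - a)) => j; rewrite inE => /predU1P[-> //|jr].
by move: t1; rewrite prodf_seq_neq0 => /allP /(_ j jr).
Qed.

(** Vanishing spreads from the grid to the whole affine space one coordinate at a time, because [S]
    has more elements than a nonzero polynomial of degree at most [d] has roots. *)
Lemma lpoly_grid d g a (v : nat -> E) s (S : seq K) :
  lpoly d g -> uniq S -> (d < size S)%N ->
  (forall t : nat -> K, (forall j, (j < s)%N -> t j \in S) ->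
     g (a + \sum_(j < s) t j *: v j) = 0) ->
  forall t : nat -> K, g (a + \sum_(j < s) t j *: v j) = 0.
Proof.
move=> gP uS dS; elim: s a => [|s IH] a g0 t.
  by rewrite big_ord0; have := g0 t; rewrite big_ord0; apply.
have {}IH z : z \in S ->
    g ((a + \sum_(j < s) t j *: v j) + z *: v s) = 0.
  move=> zS; rewrite addrAC; apply: IH => t' t'S.
  have := g0 (fun j => if (j < s)%N then t' j else z).
  rewrite big_ord_recr /= ltnn => <-; last by move=> j _; case: ifP => // /t'S.
  rewrite addrAC addrA; congr (g (_ + _ + _)).
  by apply: eq_bigr => j _; rewrite ltn_ord.
rewrite big_ord_recr /= addrA.
have [q [sq qE]] := gP (a + \sum_(j < s) t j *: v j) (v s).
rewrite qE; suff -> : q = 0 by rewrite horner0.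
apply/eqP/negPn/negP => q0.
have := max_poly_roots q0 (_ : all (root q) S) uS.
have -> : all (root q) S by apply/allP => z zS; rewrite /root -qE IH.
by move=> /(_ isT); rewrite ltnNge (leq_trans sq dS).
Qed.

End OneSpace.
End LinePoly.

(** * Algebraic dependence and multilinear maps *)

(** Base-[D] digits let the numbers [k < D ^ N] index the monomials in [N] variables with all
    exponents below [D]. *)
Definition digit (D k i : nat) : nat := (k %/ D ^ i) %% D.

Lemma digit_sum D N k : (k < D ^ N)%N -> (\sum_(i < N) digit D k i * D ^ i)%N = k.
Proof.
case: (posnP D) => [->|D0 kD].
  by case: N => [|N]; [case: k => // _; rewrite big_ord0 | rewrite exp0n].
rewrite -[RHS](modn_small kD); elim: N {kD} => [|N IH].
  by rewrite big_ord0 expn0 modn1.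
rewrite big_ord_recr /= IH /digit.
have kE : k = ((k %/ D ^ N %/ D) * D ^ N.+1 +
    ((k %/ D ^ N) %% D * D ^ N + k %% D ^ N))%N.
  by rewrite addnA expnS mulnA -mulnDl -!divn_eq.
rewrite [in RHS]kE modnMDl [RHS]modn_small; first exact: addnC.
rewrite expnS.
have := ltn_pmod (k %/ D ^ N) D0; have := ltn_pmod k (_ : 0 < D ^ N)%N.
by rewrite expn_gt0 D0 => /(_ isT); nia.
Qed.

Section AlgDep.
Variable K : fieldType.
Hypothesis Kinf : infinite_type K.

(** Monomials in the [y i] with bounded exponents outnumber the points of a grid that detects the
    vanishing of their combinations, so the matrix of their values has a left kernel vector. *)
Lemma lpoly_dependent (E : lmodType K) (s e : nat) (y : 'I_s.+1 -> E -> K)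
    (a : E) (v : nat -> E) : (forall i, lpoly e (y i)) ->
  exists (D : nat) (u : 'I_(D ^ s.+1) -> K), (exists k, u k != 0) /\
    forall t : nat -> K, \sum_k u k *
      \prod_i y i (a + \sum_(j < s) t j *: v j) ^+ digit D k i = 0.
Proof.
(* The grid will have at most [(B * (s.+1 * e).+1) ^ s = B ^ s * D] points, fewer than the
   [B ^ s.+1] monomials. *)
move=> yP; pose D := ((s.+1 * e).+1 ^ s)%N; pose B := D.+1.
pose q := (s.+1 * (B * e))%N.
have monoP (k : nat) : lpoly q (fun x => \prod_(i < s.+1) y i x ^+ digit B k i).
  have := @lpoly_prod _ _ _ (index_enum 'I_s.+1) _ _
    (fun i => @lpoly_exp _ _ _ _ (digit B k i) (yP i)).
  apply: lpoly_weaken; rewrite /q -[s.+1 in leqRHS]card_ord -sum_nat_const.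
  by apply: leq_sum => i _; rewrite leq_mul2r ltnW ?orbT ?ltn_pmod.
have [S [uS sS]] := infinite_uniq_seq q.+1 Kinf.
pose T := {ffun 'I_s -> 'I_q.+1}.
pose M := \matrix_(k < B ^ s.+1, g < #|T|)
  \prod_(i < s.+1) y i (a + \sum_(j < s) S`_(enum_val g j) *: v j) ^+ digit B k i.
have /rowV0Pn [u /sub_kermxP uM u0] : kermx M != 0.
  rewrite kermx_eq0 /row_free neq_ltn; apply/orP; left.
  apply: leq_ltn_trans (rank_leq_col M) _; rewrite card_ffun !card_ord.
  have qB : (q.+1 <= B * (s.+1 * e).+1)%N by rewrite /q; nia.
  have qBs : (q.+1 ^ s <= (B * (s.+1 * e).+1) ^ s)%N.
    by have [s0|s0] := posnP s; [rewrite s0 !expn0 | rewrite leq_exp2r].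
  apply: leq_ltn_trans qBs _.
  by rewrite expnMn expnSr ltn_pmul2l ?expn_gt0.
exists B, (fun k => u 0 k); split.
  have [k uk] := rV0Pn _ u0; by exists k.
apply: (@lpoly_grid _ _ q (fun x => \sum_k u 0 k *
    \prod_i y i x ^+ digit B k i) a v s S) => //; rewrite ?sS //.
  by apply: lpoly_sum => k; apply: lpoly_scale.
move=> t tS; pose p : T := [ffun j : 'I_s => inord (index (t j) S)].
have := congr1 (fun A : 'rV_#|T| => A 0 (enum_rank p)) uM; rewrite !mxE => uM0.
rewrite -[RHS]uM0; apply: eq_bigr => k _; rewrite mxE enum_rankK.
congr (_ * _); apply: eq_bigr => i _; congr (y i (_ + _) ^+ _).
apply: eq_bigr => j _; rewrite ffunE inordK ?nth_index ?tS //.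
by rewrite -sS index_mem tS.
Qed.

(* If all the [y i (tau w)] are [tau (w i) + O(tau^2)], the lowest-degree part
   of a relation between them would vanish at every [w]; the choice
   [w i = x ^ (D ^ i)] turns it into a nonzero polynomial in [x]. *)
Lemma lpoly_independent (N : nat) (y : 'I_N -> (nat -> K) -> K)
    (D : nat) (u : 'I_(D ^ N) -> K) :
  (forall w : nat -> K, exists r : 'I_N -> {poly K}, forall i,
     (r i).[0] = w i /\ forall z, y i (fun j => z * w j) = z * (r i).[z]) ->
  (exists k, u k != 0) ->
  exists t, \sum_k u k * \prod_i y i t ^+ digit D k i != 0.
Proof.
move=> yP [k0 uk0]; apply: NNPP => nex.
have {nex} y0 t : \sum_k u k * \prod_i y i t ^+ digit D k i = 0.
  by apply/eqP/negPn/negP => H; apply: nex; exists t.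
pose wt (k : nat) := (\sum_(i < N) digit D k i)%N.
have [k uk kmin] := @arg_minnP _ k0 (fun k => u k != 0) (fun k => wt k) uk0.
(* [Q] keeps the terms of lowest weight: as [k] minimizes [wt] on the support of [u], the test
   [wt l' <= wt k] selects equality there. *)
pose Q := \poly_(l < D ^ N) (if insub l is Some l' then
            u l' * ((wt l' <= wt k)%N%:R) else 0).
have : Q`_k = u k.
  by rewrite coef_poly ltn_ord valK leqnn mulr1.
suff -> : Q = 0 by rewrite coef0 => /esym/eqP; rewrite (negbTE uk).
apply: (horner_eq0 Kinf) => x.
have [r rP] := yP (fun i => x ^+ (D ^ i)).
(* The relation at the point [z * x ^+ (D ^ i)], divided by [z ^+ wt k]. The truncated subtraction
   is harmless since [u l = 0] when [wt l < wt k]. The value at [z = 0] is [Q.[x]]. *)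
pose P := \sum_l (u l)%:P * ('X^(wt l - wt k) * \prod_i r i ^+ digit D l i).
have P0 : P = 0.
  suff /eqP : 'X^(wt k) * P = 0.
    by rewrite mulf_eq0 expf_eq0 polyX_eq0 andbF => /eqP.
  apply: (horner_eq0 Kinf) => z; rewrite -[RHS](y0 (fun j => z * x ^+ (D ^ j))).
  rewrite hornerM horner_sum mulr_sumr; apply: eq_bigr => l _.
  have [->|ul] := eqVneq (u l) 0; first by rewrite polyC0 !mul0r horner0 mulr0.
  rewrite !(hornerM, hornerC, hornerXn) mulrCA; congr (_ * _).
  rewrite mulrA -exprD subnKC ?kmin // /wt -prodrXr horner_prod -big_split /=.
  apply: eq_bigr => i _; have [_ ->] := rP i.
  by rewrite horner_exp exprMn.
rewrite -[RHS](horner0 0) -[X in X.[0]]P0 /P horner_sum horner_poly.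
apply: eq_bigr => l _; rewrite valK -mulrA !(hornerM, hornerC, hornerXn) horner_prod.
congr (_ * _); rewrite expr0n subn_eq0; congr (_ * _).
rewrite -[in LHS](digit_sum (ltn_ord l)) expr_sum.
apply: eq_bigr => i _; have [+ _] := rP i; rewrite horner_exp => ->.
by rewrite -exprM mulnC.
Qed.

End AlgDep.

Section Multilinear.
Variables (K : fieldType) (m : nat) (V : lmodType K).
Local Notation X := {ffun 'I_m -> V}.

Definition upd (a : X) (i : 'I_m) (x : V) : X :=
  [ffun j => if j == i then x else a j].

Definition mlform (F : X -> K) : Prop := forall a i k x y,
  F (upd a i (k *: x + y)) = k * F (upd a i x) + F (upd a i y).

Lemma upd_id a i : upd a i (a i) = a.
Proof. by apply/ffunP => j; rewrite ffunE; case: eqP => // ->. Qed.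

Lemma upd_upd a i x y : upd (upd a i x) i y = upd a i y.
Proof. by apply/ffunP => j; rewrite !ffunE; case: eqP. Qed.

Lemma updC a i j x y : i != j -> upd (upd a i x) j y = upd (upd a j y) i x.
Proof.
move=> ij; apply/ffunP => k; rewrite !ffunE.
by have [->|//] := eqVneq k j; rewrite eq_sym (negbTE ij).
Qed.

(** Switching on the summands [t *: b i] slot by slot splits off [t] times the form with [b i] in
    slot [i]; to first order the other slots of that term keep their entries from [a]. *)
Lemma mlform_line (F : X -> K) (a b : X) : mlform F -> exists q : {poly K},
  [/\ (size q <= m.+1)%N, forall t, F (a + t *: b) = q.[t],
      q`_0 = F a & q`_1 = \sum_i F (upd a i (b i))].
Proof.
move=> Fml; pose mask (S : seq 'I_m) (a : X) t : X :=
  [ffun j => a j + (if j \in S then t *: b j else 0)].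
have gen (S : seq 'I_m) : uniq S -> forall a, exists q : {poly K},
  [/\ (size q <= (size S).+1)%N, forall t, F (mask S a t) = q.[t],
      q`_0 = F a & q`_1 = \sum_(i <- S) F (upd a i (b i))].
  elim: S => [_|i S IH /= /andP[iS uS]] {}a.
    exists (F a)%:P; rewrite !coefC /= big_nil; split=> //.
      exact: size_polyC_leq1.
    move=> t; rewrite hornerC; congr F.
    by apply/ffunP => j; rewrite ffunE in_nil addr0.
  have [q [sq qE q0 q1]] := IH uS a.
  have [r [sr rE r0 _]] := IH uS (upd a i (b i)).
  exists ('X * r + q); rewrite !coefD !coefXM /= add0r big_cons q1 r0 q0; split=> //.
    rewrite (leq_trans (size_polyD _ _)) // geq_max (leq_trans sq) // andbT.
    by rewrite (leq_trans (size_polyMleq _ _)) // size_polyX.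
  move=> t; rewrite hornerD hornerM hornerX -rE -qE.
  have -> : mask (i :: S) a t = upd (mask S a t) i (t *: b i + a i).
    apply/ffunP => j; rewrite !ffunE in_cons.
    by have [->|//] := eqVneq j i; rewrite addrC.
  rewrite Fml; congr (_ * F _ + F _).
    apply/ffunP => j; rewrite !ffunE.
    by have [->|//] := eqVneq j i; rewrite (negbTE iS) addr0.
  apply/ffunP => j; rewrite !ffunE.
  by have [->|//] := eqVneq j i; rewrite (negbTE iS) addr0.
have [q [sq qE q0 q1]] := gen (enum 'I_m) (enum_uniq _) a.
exists q; split=> //; first by rewrite size_enum_ord in sq.
  move=> t; rewrite -qE; congr F.
  by apply/ffunP => j; rewrite !ffunE mem_enum.
by rewrite q1 big_enum.
Qed.

Lemma mlform_lpoly F : mlform F -> lpoly m F.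
Proof. by move=> /mlform_line H a b; have [q [sq qE _ _]] := H a b; exists q. Qed.

End Multilinear.

(** * Chains of irreducible closed sets *)

Section PolyFun.
Variables (K : fieldType) (n : nat).
Implicit Types f g : 'M[K]_n -> K.

Lemma polyfun_ext f g : f =1 g -> polyfun f -> polyfun g.
Proof. by move=> /functional_extensionality ->. Qed.

Lemma polyfun_sum (I : Type) (r : seq I) (f : I -> 'M[K]_n -> K) :
  (forall i, polyfun (f i)) -> polyfun (fun A => \sum_(i <- r) f i A).
Proof.
move=> fP; elim: r => [|i r IH].
  by apply: polyfun_ext (pf_const _ 0) => A; rewrite big_nil.
by apply: polyfun_ext (pf_add (fP i) IH) => A; rewrite big_cons.
Qed.

Lemma polyfun_prod (I : Type) (r : seq I) (f : I -> 'M[K]_n -> K) :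
  (forall i, polyfun (f i)) -> polyfun (fun A => \prod_(i <- r) f i A).
Proof.
move=> fP; elim: r => [|i r IH].
  by apply: polyfun_ext (pf_const _ 1) => A; rewrite big_nil.
by apply: polyfun_ext (pf_mul (fP i) IH) => A; rewrite big_cons.
Qed.

Lemma polyfun_exp f k : polyfun f -> polyfun (fun A => f A ^+ k).
Proof.
move=> fP; elim: k => [|k IH]; first exact: pf_const.
by apply: polyfun_ext (pf_mul fP IH) => A; rewrite exprS.
Qed.

Lemma polyfun_scalar (psi : {scalar 'M[K]_n}) : polyfun psi.
Proof.
apply: (@polyfun_ext (fun A => \sum_i \sum_j A i j * psi (delta_mx i j))).
  move=> A; rewrite [A in RHS]matrix_sum_delta linear_sum.
  apply: eq_bigr => i _; rewrite linear_sum; apply: eq_bigr => j _.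
  by rewrite linearZ.
by do 2![apply: polyfun_sum => ?]; apply: pf_mul; [apply: pf_coord|apply: pf_const].
Qed.

Lemma zclosureP (X : 'M[K]_n -> Prop) A :
  zclosure X A <-> forall f, polyfun f -> (forall B, X B -> f B = 0) -> f A = 0.
Proof.
split=> [XA f fP fX|XA W [S [SP WE]] XW].
  suff /XA : zclosed (fun A => f A = 0) by apply.
  exists (fun g => g = f); split=> [g ->//|B]; split=> [fB g ->//|]; exact.
by apply/WE => f Sf; apply: XA => [|B /XW /WE]; [apply: SP|apply].
Qed.

Lemma zclosed_zclosure (X : 'M[K]_n -> Prop) : zclosed (zclosure X).
Proof.
exists (fun f => polyfun f /\ forall B, X B -> f B = 0).
split=> [f []//|A]; split=> [/zclosureP XA f [fP fX]|XA]; first exact: XA.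
by apply/zclosureP => f fP fX; apply: XA.
Qed.

Lemma sub_zclosure (X : 'M[K]_n -> Prop) : zsubset X (zclosure X).
Proof. by move=> A XA W _; apply. Qed.

Lemma zclosure_subset (X Y : 'M[K]_n -> Prop) :
  zsubset X Y -> zsubset (zclosure X) (zclosure Y).
Proof. by move=> XY A XA W WP YW; apply: XA => // B /XY /YW. Qed.

Lemma not_zsubset (X W : 'M[K]_n -> Prop) : zclosed W -> ~ zsubset (zclosure X) W ->
  exists f, [/\ polyfun f, forall A, W A -> f A = 0 & exists A, X A /\ f A != 0].
Proof.
move=> [S [SP WE]] nXW; apply: NNPP => nf; apply: nXW => A XA.
apply/WE => f Sf; apply: (proj1 (zclosureP X A) XA); first exact: SP.
move=> B XB; apply/eqP/negPn/negP => fB; apply: nf.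
exists f; split; [exact: SP | by move=> C /WE; apply | by exists B].
Qed.

End PolyFun.

Section Chain.
Variables (K : fieldType) (n m : nat) (V : lmodType K).
Hypothesis Kinf : infinite_type K.
Local Notation X := {ffun 'I_m -> V}.

Definition multilinear_map (W : lmodType K) (f : X -> W) : Prop :=
  forall a i k x y, f (upd a i (k *: x + y)) = k *: f (upd a i x) + f (upd a i y).

(** The differential at [a] of a multilinear [f], in direction [b]. *)
Definition tangent (W : lmodType K) (f : X -> W) (a b : X) : W :=
  \sum_i f (upd a i (b i)).

Lemma tangent_linear (W : lmodType K) (f : X -> W) a :
  multilinear_map f -> exists T : {linear X -> W}, T =1 tangent f a.
Proof.
move=> fml; have Tlin : linear (tangent f a).
  move=> k x y; rewrite /tangent scaler_sumr -big_split /=.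
  by apply: eq_bigr => i _; rewrite !ffunE fml.
pose T0 := GRing.isLinear.Build K X W *:%R (tangent f a) Tlin.
by exists (HB.pack_for {linear X -> W} (tangent f a) T0).
Qed.

Variable f : X -> 'M[K]_n.
Hypothesis fml : multilinear_map f.

Lemma mlform_scalar (psi : {scalar 'M[K]_n}) : mlform (fun x => psi (f x)).
Proof. by move=> a i k x y; rewrite fml linearP. Qed.

Lemma mlform_entry i j : mlform (fun x => f x i j).
Proof. by move=> a k z x y; rewrite fml !mxE. Qed.

Lemma polyfun_lpoly g : polyfun g -> exists d, lpoly d (fun x => g (f x)).
Proof.
elim=> [c|i j|g1 g2 _ [d1 H1] _ [d2 H2]|g1 g2 _ [d1 H1] _ [d2 H2]].
- by exists 0%N; apply: lpoly_const.
- by exists m; apply: mlform_lpoly; apply: mlform_entry.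
- exists (maxn d1 d2); apply: lpoly_add.
    by apply: lpoly_weaken H1; rewrite leq_maxl.
  by apply: lpoly_weaken H2; rewrite leq_maxr.
- by exists (d1 + d2)%N; apply: lpoly_mul.
Qed.

Variables (a : X) (v : nat -> X).

Definition affpt (s : nat) (t : nat -> K) : X := a + \sum_(j < s) t j *: v j.

Definition affimage (s : nat) : 'M[K]_n -> Prop :=
  fun A => exists t, A = f (affpt s t).

Lemma affpt_line s t t' z :
  affpt s t + z *: (affpt s t' - affpt s t) = affpt s (fun j => t j + z * (t' j - t j)).
Proof.
rewrite /affpt opprD addrACA subrr add0r -sumrB scaler_sumr -addrA -big_split /=.
by congr (_ + _); apply: eq_bigr => j _; rewrite -scalerBl scalerA -scalerDl.
Qed.

Lemma affimageS s : zsubset (affimage s) (affimage s.+1).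
Proof.
move=> _ [t ->]; exists (fun j => if (j < s)%N then t j else 0).
rewrite /affpt big_ord_recr /= ltnn scale0r addr0; congr (f (_ + _)).
by apply: eq_bigr => j _; rewrite ltn_ord.
Qed.

(** If neither closed set contains the image, each is avoided at some parameter, as witnessed by a
    polynomial function; on the line joining the two parameters both functions are nonzero at a
    common point. *)
Lemma zirreducible_affimage s : zirreducible (zclosure (affimage s)).
Proof.
split; first exact: zclosed_zclosure.
  by exists (f (affpt s (fun=> 0))); apply: sub_zclosure; exists (fun=> 0).
move=> U W Ucl Wcl ZUW; apply: NNPP => /not_or_and [nU nW].
have [g [gP gU [_ [[t ->] gt]]]] := not_zsubset Ucl nU.
have [h [hP hW [_ [[t' ->] ht]]]] := not_zsubset Wcl nW.
have [d1 g1] := polyfun_lpoly gP; have [d2 h2] := polyfun_lpoly hP.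
have [z [gz hz]] := lpoly_line_neq0 Kinf g1 h2 gt ht.
have /ZUW [/gU/eqP|/hW/eqP] : zclosure (affimage s)
    (f (affpt s t + z *: (affpt s t' - affpt s t))).
- by apply: sub_zclosure; rewrite affpt_line; eexists.
- by rewrite (negbTE gz).
- by rewrite (negbTE hz).
Qed.

(** The [s.+1] functions [psi i (f x) - psi i (f a)] satisfy an algebraic relation on [s]
    parameters. On [s.+1] parameters their linear parts are independent coordinates, so the same
    relation fails at some point of the larger image. *)
Lemma affimage_strict s (psi : 'I_s.+1 -> {scalar 'M[K]_n}) :
  (forall i j, psi i (tangent f a (v (nat_of_ord j))) = (i == j)%:R) ->
  exists A, zclosure (affimage s.+1) A /\ ~ zclosure (affimage s) A.
Proof.
move=> psiP; pose y i x := psi i (f x) + - psi i (f a).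
have yP i : lpoly m (y i).
  by apply: lpoly_add; [apply/mlform_lpoly/mlform_scalar | apply: lpoly_const].
have [D [u [u0 uE]]] := lpoly_dependent Kinf a v yP.
have [|t tP] := @lpoly_independent _ Kinf s.+1
    (fun i t => y i (affpt s.+1 t)) D u _ u0.
  have [T TE] := tangent_linear a fml.
  move=> w; pose b := \sum_(j < s.+1) w j *: v j.
  have rP (i : 'I_s.+1) : exists r : {poly K}, r.[0] = w i /\
      forall z, y i (affpt s.+1 (fun j => z * w j)) = z * r.[z].
    have [q [_ qE q0 q1]] := mlform_line a b (mlform_scalar (psi i)).
    (* This is [q] without its constant term, divided by ['X]; its value at [0] is the linear
       coefficient [psi i (tangent f a b) = w i]. *)
    exists (drop_poly 1 q); split.
      rewrite horner_coef0 coef_drop_poly add0n q1 -linear_sum /=.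
      rewrite -/(tangent f a b) -TE !linear_sum (bigD1 i) //= linearZ scalarZ TE psiP.
      rewrite eqxx mulr1 big1 ?addr0 // => j ji.
      by rewrite linearZ scalarZ TE psiP eq_sym (negbTE ji) mulr0.
    move=> z; rewrite /y /affpt.
    have -> : \sum_(j < s.+1) (z * w j) *: v j = z *: b.
      by rewrite scaler_sumr; apply: eq_bigr => j _; rewrite scalerA.
    have qX : q = (q`_0)%:P + drop_poly 1 q * 'X.
      rewrite -{1}[q](poly_take_drop 1) expr1; congr (_ + _).
      by apply/polyP => -[|k]; rewrite coef_take_poly coefC.
    by rewrite qE -q0 {1}qX hornerD hornerMX hornerC addrC addKr mulrC.
  by have [r rP'] := fin_all_exists rP; exists r.
exists (f (affpt s.+1 t)); split; first by apply: sub_zclosure; exists t.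
move=> /zclosureP /(_ (fun A => \sum_k u k *
  \prod_i (psi i A + - psi i (f a)) ^+ digit D k i)) H.
move: tP; rewrite H ?eqxx //.
  apply: polyfun_sum => k; apply: pf_mul; first exact: pf_const.
  apply: polyfun_prod => i; apply: polyfun_exp; apply: pf_add; last exact: pf_const.
  exact: polyfun_scalar.
by move=> _ [t' ->]; apply: uE.
Qed.

End Chain.

(** * Dimension bounds from tangent spaces *)

Theorem zdim_ge_tangent (K : fieldType) (n m : nat) (V : lmodType K)
    (f : {ffun 'I_m -> V} -> 'M[K]_n) (a : {ffun 'I_m -> V})
    (U : {vspace 'M[K]_n}) (d : nat) :
  infinite_type K -> multilinear_map f ->
  (forall A, A \in U -> exists b, tangent f a b = A) -> (d <= \dim U)%N ->
  zdim_ge (zclosure (fun A => exists x, A = f x)) d.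
Proof.
move=> Kinf fml UP dU.
have vP (j : 'I_(\dim U)) : exists b, tangent f a b = (vbasis U)`_j.
  by apply: UP; rewrite vbasis_mem // mem_nth // size_tuple.
have [v' v'P] := fin_all_exists vP.
(* Only indices [j < d <= \dim U] enter the chain up to [d], so the default [0] is not reached
   there. *)
pose v j := if insub j is Some j' then v' j' else 0.
exists (fun s => zclosure (affimage f a v s)); split=> [s _|s sd|].
- exact: zirreducible_affimage.
- split; first by apply: zclosure_subset; apply: affimageS.
  have sU : (s.+1 <= \dim U)%N := leq_trans sd dU.
  apply: (affimage_strict Kinf fml
    (psi := fun i => coord (vbasis U) (widen_ord sU i))) => i j.
  have -> : v j = v' (widen_ord sU j).
    rewrite /v (insubT (fun k => k < \dim U)%N (leq_trans (ltn_ord j) sU)).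
    by congr v'; apply: val_inj.
  rewrite v'P eq_sym.
  exact: (coord_free (widen_ord sU j) (widen_ord sU i) (basis_free (vbasisP U))).
- by apply: zclosure_subset => _ [t ->]; eexists.
Qed.

(** A complement of the row space of [M] yields at most [n - r] further diagonal matrices, which
    together with [U] span all matrices. *)
Lemma dim_offdiag_diag (K : fieldType) (n r : nat) (U : {vspace 'M[K]_n})
    (M : 'M[K]_(r, n)) :
  (forall i j, i != j -> delta_mx i j \in U) ->
  row_free M -> (forall k, diag_mx (row k M) \in U) ->
  (n * n - n + r <= \dim U)%N.
Proof.
move=> Uoff Mfree Udiag.
pose B := row_base M^C%MS.
pose W := <<[seq diag_mx (row k B) | k : 'I_(\rank M^C)]>>%VS.
have dimW : (\dim W <= n - r)%N.
  apply: leq_trans (dim_span _) _.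
  by rewrite size_map size_enum_ord mxrank_compl (eqP Mfree).
have UW i j : delta_mx i j \in (U + W)%VS.
  have [<-|ij] := eqVneq i j; last by rewrite (subvP (addvSl _ _)) // Uoff.
  have : ((delta_mx 0 i : 'rV[K]_n) <= M + B)%MS.
    apply: submx_trans (submx_full _ (addsmx_compl_full M)) _.
    by apply: addsmxS; rewrite ?submx_refl // eq_row_base.
  case/sub_addsmxP => -[x y] /= xy.
  have -> : delta_mx i i = diag_mx (x *m M) + diag_mx (y *m B).
    rewrite -linearD -xy; apply/matrixP => k l; rewrite !mxE eqxx /=.
    have [->|] := eqVneq k i; last by rewrite mul0rn.
    by rewrite eq_sym; case: eqP.
  rewrite !mulmx_sum_row !linear_sum.
  apply: memv_add; apply: memv_suml => k _; rewrite linearZ; apply: memvZ.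
    exact: Udiag.
  by apply: memv_span; apply: map_f; rewrite mem_enum.
have : (\dim {:'M[K]_n} <= \dim U + \dim W)%N.
  apply: leq_trans (dimvS _) (dimv_add_leqif U W).1.
  apply/subvP => A _; rewrite [A]matrix_sum_delta.
  by apply: memv_suml => i _; apply: memv_suml => j _; apply: memvZ.
rewrite dimvf /dim /=.
have rn : (r <= n)%N by rewrite -(eqP Mfree) rank_leq_col.
by have : (n <= n * n)%N by [case: (n) => // k; rewrite leq_pmulr]; lia.
Qed.

(** * Multilinear maps with values outside a plane *)

Section Plane.
Variables (K : fieldType) (m N : nat) (V : lmodType K).
Hypothesis Kinf : infinite_type K.
Local Notation X := {ffun 'I_m -> V}.

Lemma lpoly_upd d (g : X -> K) i b : lpoly d g -> lpoly d (fun x => g (upd x i b)).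
Proof.
move=> gP a c; have [q [sq qE]] := gP (upd a i b) (upd c i 0).
exists q; split=> // t; rewrite -qE; congr g; apply/ffunP => j; rewrite !ffunE.
by case: eqP => // _; rewrite scaler0 addr0.
Qed.

(** The point moves from [a0] to [b] by replacing one slot at a time. The step is available only
    where [g] is nonzero, which suffices because [g] is nonzero at [a0] and hence generically on
    every line through it. *)
Lemma lpoly_submx_propagate (C : Type) (r d e : nat) (G : C -> X -> 'rV[K]_N)
    (P : 'M[K]_(r, N)) (g : X -> K) (a0 : X) :
  (forall c j, lpoly d (fun x => G c x 0 j)) -> lpoly e g -> g a0 != 0 ->
  (forall c, (G c a0 <= P)%MS) ->
  (forall a, g a != 0 -> (forall c, (G c a <= P)%MS) ->
     forall i b c, (G c (upd a i b) <= P)%MS) ->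
  forall b c, (G c b <= P)%MS.
Proof.
move=> GP gP g0 H0 Hstep b c.
pose hyb (k : nat) (b : X) : X := [ffun j : 'I_m => if (j < k)%N then b j else a0 j].
suff hP k : (k <= m)%N -> forall b c, (G c (hyb k b) <= P)%MS.
  have -> : b = hyb m b by apply/ffunP => j; rewrite ffunE ltn_ord.
  exact: hP.
elim: k => [_|k IH km] {}b {}c.
  by have -> : hyb 0%N b = a0 by apply/ffunP => j; rewrite ffunE.
pose i := Ordinal km.
have -> : hyb k.+1 b = upd (hyb k b) i (b i).
  apply/ffunP => j; rewrite !ffunE ltnS leq_eqVlt -(inj_eq val_inj) /=.
  by case: eqP => // ji; rewrite (_ : j = i) //; apply: val_inj.
rewrite submxE; apply/eqP/matrixP => x j; rewrite (ord1 x) [RHS]mxE.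
pose h x := (G c x *m cokermx P) 0 j.
have hlp : lpoly d h.
  apply: (@lpoly_ext _ _ d (fun x => \sum_l cokermx P l j * G c x 0 l)).
    by move=> y; rewrite /h mxE; apply: eq_bigr => l _; rewrite mulrC.
  by apply: lpoly_sum => l; apply: lpoly_scale.
(* The line from [a0] to [hyb k b] consists of hybrids, so the induction hypothesis holds along it;
   the change of slot [i] at its generic points extends to [t = 1]. *)
have H1 t : hyb k (a0 + t *: (b - a0)) = a0 + t *: (hyb k b - a0).
  apply/ffunP => l; rewrite !ffunE.
  by case: ifP => // _; rewrite subrr scaler0 addr0.
have -> : hyb k b = a0 + 1 *: (hyb k b - a0) by rewrite scale1r addrC subrK.
apply: (lpoly_line_eq0 Kinf gP (lpoly_upd i (b i) hlp) g0) => t gt.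
have Gt c' : (G c' (a0 + t *: (hyb k b - a0))%R <= P)%MS.
  by rewrite -H1; apply: IH; apply: ltnW.
have := Hstep _ gt Gt i (b i) c.
by rewrite submxE /h => /eqP ->; rewrite mxE.
Qed.

(** For a right inverse [C] of [M a], the determinant of [M x *m C] is a polynomial certificate of
    full row rank. *)
Lemma row_free_lpoly (E : lmodType K) (r d : nat) (M : E -> 'M[K]_(r, N)) a :
  (forall i j, lpoly d (fun x => M x i j)) -> row_free (M a) ->
  exists e g, [/\ lpoly e g, g a != 0 & forall x, g x != 0 -> row_free (M x)].
Proof.
move=> MP /row_freeP [C MC]; exists (r * d)%N, (fun x => \det (M x *m C)); split.
- apply: lpoly_det => i j.
  apply: (@lpoly_ext _ _ d (fun x => \sum_l C l j * M x i l)).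
    by move=> y; rewrite mxE; apply: eq_bigr => l _; rewrite mulrC.
  by apply: lpoly_sum => l; apply: lpoly_scale.
- by rewrite MC det1 oner_neq0.
- move=> x; rewrite -unitfE -unitmxE => U; apply/row_freeP.
  by exists (C *m invmx (M x *m C)); rewrite mulmxA mulmxV.
Qed.

Variable R : X -> 'rV[K]_N.
Hypothesis Rml : multilinear_map R.

Definition partials (r : nat) (p : 'I_r -> 'I_m * V) (a : X) : 'M[K]_(r, N) :=
  \matrix_k R (upd a (p k).1 (p k).2).

Lemma lpoly_partials r (p : 'I_r -> 'I_m * V) i j :
  lpoly m (fun x => partials p x i j).
Proof.
apply: (@lpoly_ext _ _ m (fun x => R (upd x (p i).1 (p i).2) 0 j)).
  by move=> x; rewrite mxE.
apply: (@lpoly_upd m (fun x => R x 0 j)); apply: mlform_lpoly.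
by move=> a k z x y; rewrite Rml !mxE.
Qed.

Definition extend r (p : 'I_r -> 'I_m * V) i b (k : 'I_r.+1) : 'I_m * V :=
  if unlift ord_max k is Some k' then p k' else (i, b).

Lemma partials_extend r (p : 'I_r -> 'I_m * V) i b a :
  row_free (partials p a) -> ~~ (R (upd a i b) <= partials p a)%MS ->
  row_free (partials (extend p i b) a).
Proof.
move=> Mfree Mnot; rewrite -row_leq_rank -[r in (r.+1 <= _)%N](eqP Mfree).
apply: rank_ltmx; rewrite ltmxE; apply/andP; split.
  apply/row_subP => k; rewrite rowK.
  have -> : R (upd a (p k).1 (p k).2) =
    row (lift ord_max k) (partials (extend p i b) a) by rewrite rowK /extend liftK.
  exact: row_sub.
apply: contra Mnot => /row_subP /(_ ord_max).
by rewrite rowK /extend unlift_none.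
Qed.

(** If changing a slot never leaves the line of a nonzero [R a], propagation puts all values on one
    line. Otherwise some slot [i] gives two independent partial values; were a third always missing,
    the plane they span, which does not depend on the entry in slot [i], would contain all
    values. *)
Lemma multilinear_partials3 :
  (forall P : 'M[K]_(2, N), exists x, ~~ (R x <= P)%MS) ->
  exists (p : 'I_3 -> 'I_m * V) a, row_free (partials p a).
Proof.
move=> RP; apply: NNPP => nfree.
have eqP_sub r (A B : 'M[K]_(r, N)) : row_free A -> (A <= B)%MS -> (B <= A)%MS.
  move=> Af AB; rewrite -(geq_leqif (mxrank_leqif_sup AB)) (eqP Af).
  exact: rank_leq_row.
have Rlp j : lpoly m (fun x => R x 0 j).
  by apply: mlform_lpoly => a k z x y; rewrite Rml !mxE.
have [a0 Ra0] : exists a, R a != 0.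
  have [x Rx] := RP 0; exists x.
  by apply: contraNneq Rx => ->; apply: sub0mx.
have [line|nline] :=
    classic (forall a i b, R a != 0 -> (R (upd a i b) <= R a)%MS).
  have Rfree a : row_free (R a) = (R a != 0).
    by rewrite /row_free rank_rV; case: (R a != 0).
  have [|e [g [gP g0 gF]]] := @row_free_lpoly _ 1 m R a0 _ (eq_ind_r is_true Ra0 (Rfree a0)).
    by move=> i j; rewrite (ord1 i).
  have [x /negP] := RP (col_mx (R a0) (0 : 'rV_N)); apply.
  apply: (submx_trans (B := R a0)); last first.
    by have := addsmxSl (R a0) (0 : 'rV_N); rewrite addsmxE.
  apply: (@lpoly_submx_propagate unit 1 m e (fun=> R) (R a0) g a0) => //.
  move=> a ga /(_ tt) Ra i b _; apply: submx_trans Ra.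
  by apply: line; rewrite -Rfree gF.
have {nline} [a [i [b [Ra Rb]]]] : exists a i b, R a != 0 /\ ~~ (R (upd a i b) <= R a)%MS.
  apply: NNPP => nex; apply: nline => a i b Ra; apply/negPn/negP => Rb.
  by apply: nex; exists a, i, b.
(* Both chosen entries go into slot [i], the entry [a i] giving back [R a]; so [partials p2] is
   insensitive to slot [i]. *)
pose p0 (k : 'I_0) : 'I_m * V := (i, 0).
pose p1 := extend p0 i (a i); pose p2 := extend p1 i b.
have p2i k : (p2 k).1 = i.
  rewrite /p2 /p1 /extend; case: unliftP => //= k' _; by case: unliftP.
have free1 : row_free (partials p1 a).
  apply: partials_extend; first by rewrite -row_leq_rank.
  rewrite upd_id; apply: contra Ra => Ra; apply/eqP.
  by apply: (@submx0null _ 1 1); apply: submx_trans Ra _; rewrite [partials p0 a]flatmx0 sub0mx.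
have free2 : row_free (partials p2 a).
  apply: partials_extend free1 _; apply: contra Rb => /submx_trans; apply.
  apply/row_subP => k; rewrite rowK /p1 /extend.
  by case: unliftP => [[]//|_] /=; rewrite upd_id submx_refl.
have sub2 c i' b' : row_free (partials p2 c) -> (R (upd c i' b') <= partials p2 c)%MS.
  move=> fc; apply/negPn/negP => H; apply: nfree.
  by exists (extend p2 i' b'), c; apply: partials_extend.
have [e [g [gP g0 gF]]] := row_free_lpoly (@lpoly_partials _ p2) free2.
have [x /negP] := RP (partials p2 a); apply; rewrite -[x](upd_id x i).
(* Slot [i] is left free as the parameter [c], so that the invariant keeps the rows of [partials p2]
   at each point reached inside the fixed plane. *)
apply: (@lpoly_submx_propagate V 2 m e (fun c x => R (upd x i c))
  (partials p2 a) g a) => // [c j|c|c gc cP i' b' z].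
- exact: (@lpoly_upd m (fun x => R x 0 j)).
- exact: sub2.
have pc : (partials p2 c <= partials p2 a)%MS.
  by apply/row_subP => k; rewrite rowK p2i.
have [<-|ii'] := eqVneq i i'; first by rewrite upd_upd.
rewrite updC 1?eq_sym //; apply: submx_trans pc.
have pz : partials p2 (upd c i z) = partials p2 c.
  by apply/row_matrixP => k; rewrite !rowK p2i upd_upd.
by rewrite -pz; apply: sub2; rewrite pz gF.
Qed.

End Plane.

(** * Cyclic arrangements *)

Lemma perm_eq_block (T : eqType) (v : T) (l : seq T) :
  perm_eq l (nseq (count_mem v l) v ++ [seq x <- l | x != v]).
Proof.
have <- : [seq x <- l | x == v] = nseq (count_mem v l) v.
  rewrite -size_filter; apply/all_pred1P; exact: filter_all.
by rewrite perm_sym; apply/permPl; apply: (perm_filterC (pred1 v)).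
Qed.

Lemma size_le_count2 (T : eqType) (x y : T) (s : seq T) :
  all [in [:: x; y]] s -> (size s <= count_mem x s + count_mem y s)%N.
Proof.
elim: s => //= z s IH /andP[+ /IH]; rewrite !inE.
by case: (z == x) (z == y) => -[] //= _; lia.
Qed.

(** Two values fill at most four places, so a third one occurs. *)
Lemma pick3 (T : eqType) (l : seq T) : (5 <= size l)%N ->
  (forall v, (count_mem v l <= 2)%N) ->
  exists x y z s, [/\ perm_eq l [:: x, y, z & s], x != y, x != z & y != z].
Proof.
case: l => [//|x l] /= sl cl.
have /hasP [y yl yx] : has (fun y => y != x) l.
  rewrite has_predC; apply/negP => /all_pred1P lE.
  by have := cl x; rewrite eqxx lE count_nseq /= eqxx; lia.
have /perm_to_rem := yl; set s1 := rem y l => pl.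
have cs1 v : (count_mem v s1 + (y == v) + (x == v) <= 2)%N.
  by have := cl v; rewrite (seq.permP pl) /=; lia.
have ss1 : (3 <= size s1)%N by have := perm_size pl; rewrite /=; lia.
have /allPn [z zs1] : ~~ all [in [:: x; y]] s1.
  apply/negP => /size_le_count2; have := cs1 x; have := cs1 y.
  by rewrite !eqxx; lia.
rewrite !inE negb_or => /andP[zx zy].
exists x, y, z, (rem z s1); rewrite eq_sym yx eq_sym zx eq_sym zy; split=> //.
rewrite perm_cons; apply: perm_trans pl _; rewrite perm_cons.
exact: perm_to_rem.
Qed.

Lemma count1_index (T : eqType) (x0 v : T) (l : seq T) j :
  count_mem v l = 1%N -> (j < size l)%N -> nth x0 l j = v -> j = index v l.
Proof.
elim: l j => //= x l IH [|j]; have [->|xv] //= := eqVneq x v.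
- by move=> _ _ xv'; rewrite xv' eqxx in xv.
- move=> [cv] jl jv; have : (0 < count_mem v l)%N.
    by rewrite -has_count has_pred1 -jv mem_nth.
  by rewrite add0n in cv; rewrite cv.
- by rewrite add0n => cv jl jv; rewrite (IH j).
Qed.

Section Arrangement.
Variables (K : fieldType) (k : nat).
Local Notation n := (k.+4.+1).
Implicit Types (l : seq K) (d : 'I_n -> K).

Definition aperiodic d : Prop :=
  forall q, (forall i, d (i + q) = d i) -> q = 0.

(** Equivalently, the windows [d q, d (q + 1), d (q + 2%:R)] span [K^3]; then no plane contains all
    cyclic shifts of [d]. *)
Definition no_recurrence2 d : Prop :=
  forall al be ga, (forall q, al * d q + be * d (q + 1) + ga * d (q + 2%:R) = 0) ->
  [/\ al = 0, be = 0 & ga = 0].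

(** A nonzero period would carry the only occurrence of the pattern [P] to another one. *)
Lemma aperiodic_marker d (P : K -> K -> bool) i0 :
  P (d i0) (d (i0 + 1)) -> (forall j, P (d j) (d (j + 1)) -> j = i0) ->
  aperiodic d.
Proof.
move=> P0 Pu q dq; apply: (addrI i0); rewrite addr0; apply: Pu.
by rewrite addrAC !dq.
Qed.

Lemma recurrence_windows l al be ga : size l = n ->
  (forall q : 'I_n, al * l`_q + be * l`_(q + 1)%R + ga * l`_(q + 2%:R)%R = 0) ->
  (forall i, (i.+2 < n)%N -> al * l`_i + be * l`_i.+1 + ga * l`_i.+2 = 0) /\
  al * l`_k.+4 + be * l`_0 + ga * l`_1 = 0.
Proof.
move=> sl rec; split=> [i ik|].
  have := rec (inord i); rewrite /= !inordK; try lia.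
  rewrite [(1 %% _)%N]modn_small // [((1 + 1) %% _)%N]modn_small //.
  by rewrite !modn_small ?addn1 ?addn2 //; lia.
have := rec ord_max; rewrite /=.
rewrite [(1 %% _)%N]modn_small // [((1 + 1) %% _)%N]modn_small //.
by rewrite addn1 modnn [(k.+4 + (1 + 1))%N]addnA [(k.+4 + 1)%N]addn1 modnDl modn_small.
Qed.

(** The end of the block is the only place where [v] is followed by another value. *)
Lemma block_aperiodic l v r : size l = n -> (0 < r < n)%N ->
  (forall i, (i < n)%N -> (l`_i == v) = (i < r)%N) ->
  aperiodic (fun i => l`_i).
Proof.
move=> sl /andP[r0 rn] lv.
have succ (i : 'I_n) : (i < r)%N -> nat_of_ord (i + 1) = i.+1.
  by move=> ir /=; rewrite [(1 %% _)%N]modn_small // addn1 modn_small //; lia.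
have r1 : (r.-1 < n)%N by lia.
apply: (@aperiodic_marker _ (fun x y => (x == v) && (y != v)) (Ordinal r1)).
  by rewrite (succ (Ordinal r1)) /= ?lv; lia.
move=> j; rewrite lv // => /andP[jr]; rewrite succ // lv; last by lia.
by move=> jr'; apply: val_inj => /=; lia.
Qed.

Definition arrangement_ok l := aperiodic (fun i : 'I_n => l`_i) /\
  no_recurrence2 (fun i : 'I_n => l`_i).

(** The window [v, v, v], or [v = 0], makes the recurrence vanish on constant [v]. Comparison with
    the window leaving the block gives [ga = 0], and with the one entering it cyclically gives
    [al = 0]; then [be] kills every entry, and not all are zero. *)
Lemma arrangement_block l v s r : l = nseq r v ++ s -> size l = n ->
  (2 <= r)%N -> v \notin s -> (0 < size s)%N -> (3 <= r)%N || (v == 0) ->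
  arrangement_ok l.
Proof.
move=> lE sl r2 vs s0 rv.
have srn : (r + size s)%N = n by rewrite -sl lE size_cat size_nseq.
have lv i : (i < n)%N -> (l`_i == v) = (i < r)%N.
  move=> ik; rewrite lE nth_cat size_nseq.
  case: ltnP => ir; first by rewrite nth_nseq ir eqxx.
  by apply/negbTE; apply: contraNneq vs => <-; apply: mem_nth; rewrite ltn_subLR ?srn.
have lv' i : (i < r)%N -> l`_i = v by move=> ir; apply/eqP; rewrite lv //; lia.
split; first by apply: (@block_aperiodic _ v r) => //; lia.
move=> al be ga rec; have [win wrap] := recurrence_windows sl rec.
have sum0 : al * v + be * v + ga * v = 0.
  have [r3|] := boolP (3 <= r)%N; last first.
    by case/orP: rv => [-> //|/eqP -> _]; rewrite !mulr0 !addr0.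
  by have := win 0%N isT; rewrite !lv' //; lia.
have lr : l`_r != v by rewrite lv ?ltnn //; lia.
have ga0 : ga = 0.
  have : ga * (l`_r - v) = 0.
    have r2n : ((r - 2).+2 < n)%N by lia.
    have := win _ r2n; have -> : (r - 2).+1 = r.-1 by lia.
    have -> : r.-1.+1 = r by lia.
    rewrite (lv' (r - 2)%N) ?(lv' r.-1); try lia; move=> w.
    have -> : ga * (l`_r - v) =
      (al * v + be * v + ga * l`_r) - (al * v + be * v + ga * v) by ring.
    by rewrite w sum0 subr0.
  by move/eqP; rewrite mulf_eq0 subr_eq0 (negbTE lr) orbF => /eqP.
have al0 : al = 0.
  have : al * (l`_k.+4 - v) = 0.
    rewrite (lv' 0%N) ?(lv' 1%N) in wrap; try lia.
    have -> : al * (l`_k.+4 - v) =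
      (al * l`_k.+4 + be * v + ga * v) - (al * v + be * v + ga * v) by ring.
    by rewrite wrap sum0 subr0.
  move/eqP; rewrite mulf_eq0 subr_eq0 lv //.
  rewrite (_ : (k.+4 < r)%N = false) ?orbF; last by lia.
  by move/eqP.
split=> //.
have be0 (i : 'I_n) : be * l`_i = 0.
  by have := rec (i - 1); rewrite al0 ga0 !mul0r add0r addr0 subrK.
have [v0|v0] := eqVneq v 0.
  have rn : (r < n)%N by lia.
  have /eqP := be0 (Ordinal rn).
  rewrite mulf_eq0 => /orP[/eqP //|/eqP /= l0].
  by move: lr; rewrite l0 v0 eqxx.
move/eqP: (be0 0); rewrite mulf_eq0 lv'; last by rewrite /=; lia.
by rewrite (negbTE v0) orbF => /eqP.
Qed.

(** The windows [x, x, z] and [y, y, z] give [al + be = 0] and then [ga = 0]; the window [x, z, y]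
    leaves [al * (x - z) = 0]. *)
Lemma arrangement_pairs l s x y z :
  l = [:: x; x; z; y; y; z] ++ s -> size l = n ->
  x \notin s -> x != y -> x != z -> z != 0 -> arrangement_ok l.
Proof.
move=> lE sl xs xy xz z0.
have lv i : (i < n)%N -> (l`_i == x) = (i < 2)%N.
  move=> ik; have [i6|i6] := ltnP i 6%N.
    by rewrite lE; case: i i6 {ik} => [|[|[|[|[|[|i]]]]]] //= _;
      rewrite ?eqxx // eq_sym; apply/negbTE.
  rewrite lE nth_cat ltnNge i6 /=; have -> : (i < 2)%N = false by lia.
  apply/negbTE; apply: contraNneq xs => <-; apply: mem_nth.
  by rewrite ltn_subLR // (_ : (6 + size s)%N = n) // -sl lE.
split; first by apply: (@block_aperiodic _ x 2).
move=> al be ga rec; have [win _] := recurrence_windows sl rec.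
have w0 : al * x + be * x + ga * z = 0 by have := win 0%N isT; rewrite lE.
have w3 : al * y + be * y + ga * z = 0.
  by have := win 3%N; rewrite lE /=; apply; rewrite lE /= in sl; lia.
have ab : al + be = 0.
  have /eqP : (al + be) * (x - y) = 0.
    have -> : (al + be) * (x - y) =
      (al * x + be * x + ga * z) - (al * y + be * y + ga * z) by ring.
    by rewrite w0 w3 subr0.
  by rewrite mulf_eq0 subr_eq0 (negbTE xy) orbF => /eqP.
have ga0 : ga = 0.
  move/eqP: w0; rewrite -mulrDl ab mul0r add0r mulf_eq0 (negbTE z0) orbF.
  by move/eqP.
have al0 : al = 0.
  have := win 1%N isT; rewrite lE /= ga0 mul0r addr0.
  have -> : be = - al by apply/eqP; rewrite -addr_eq0 addrC ab.
  rewrite mulNr -mulrBr => /eqP; rewrite mulf_eq0 subr_eq0 (negbTE xz) orbF.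
  by move/eqP.
by split=> //; move: ab; rewrite al0 add0r.
Qed.

(* The determinant of the Hankel matrix with rows [x0 x1 x2], [x1 x2 x3] and
   [x2 x3 x4]. *)
Definition hankel (x0 x1 x2 x3 x4 : K) : K :=
  x0 * x2 * x4 - x0 * x3 ^+ 2 - x1 ^+ 2 * x4 + (x1 * x2 * x3) *+ 2 - x2 ^+ 3.

(** So if the ends differ and [x ^+ 2 != y ^+ 2], one of the two orders of the ends has a nonzero
    determinant. *)
Lemma hankel_swap (i x w y j : K) :
  hankel i x w y j - hankel j x w y i = (i - j) * (x ^+ 2 - y ^+ 2).
Proof. by rewrite /hankel; ring. Qed.

Lemma arrangement_hankel l s x0 x1 x2 x3 x4 v :
  l = [:: x0, x1, x2, x3, x4 & s] -> size l = n ->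
  hankel x0 x1 x2 x3 x4 != 0 -> count_mem v l = 1%N -> arrangement_ok l.
Proof.
move=> lE sl h0 cv; split.
  have vl : v \in l by rewrite -has_pred1 has_count cv.
  have il : (index v l < n)%N by rewrite -sl index_mem.
  apply: (@aperiodic_marker _ (fun x _ => x == v) (Ordinal il)).
    by rewrite /= nth_index.
  move=> j /eqP jv; apply: val_inj => /=.
  by apply: (count1_index cv) jv; rewrite sl.
move=> al be ga rec; have [win _] := recurrence_windows sl rec.
have w0 := win 0%N isT; have w1 := win 1%N isT; have w2 := win 2%N isT.
rewrite lE /= in w0 w1 w2.
have cancelh x : x * hankel x0 x1 x2 x3 x4 = 0 -> x = 0.
  by move/eqP; rewrite mulf_eq0 (negbTE h0) orbF => /eqP.
have combine c0 c1 c2 : c0 * (al * x0 + be * x1 + ga * x2)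
    + c1 * (al * x1 + be * x2 + ga * x3) + c2 * (al * x2 + be * x3 + ga * x4) = 0.
  by rewrite w0 w1 w2 !mulr0 !addr0.
(* The multipliers below are the rows of the adjugate of the Hankel matrix. *)
split; apply: cancelh.
- rewrite -(combine (x2 * x4 - x3 ^+ 2) (x2 * x3 - x1 * x4) (x1 * x3 - x2 ^+ 2)).
  by rewrite /hankel; ring.
- rewrite -(combine (x2 * x3 - x1 * x4) (x0 * x4 - x2 ^+ 2) (x1 * x2 - x0 * x3)).
  by rewrite /hankel; ring.
- rewrite -(combine (x1 * x3 - x2 ^+ 2) (x1 * x2 - x0 * x3) (x0 * x2 - x1 ^+ 2)).
  by rewrite /hankel; ring.
Qed.

(** A value occurring three times, or zero occurring twice, is gathered in a block. Failing that, a
    value occurring once allows a Hankel arrangement. Failing both, all values are nonzero and occur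
    exactly twice, and three of them are arranged in pairs. *)
Lemma arrangement_exists l : size l = n -> ~~ constant l ->
  exists l', perm_eq l' l /\ arrangement_ok l'.
Proof.
move=> sl nconst.
have [/hasP [v vl cv]|small] := boolP (has (fun v =>
    (3 <= count_mem v l)%N || (2 <= count_mem v l)%N && (v == 0)) l).
  have pl := perm_eq_block v l.
  exists (nseq (count_mem v l) v ++ [seq x <- l | x != v]).
  rewrite perm_sym; split=> //; apply: arrangement_block => //.
  - by rewrite -(perm_size pl).
  - by case/orP: cv => [|/andP[]//]; lia.
  - by rewrite mem_filter eqxx.
  - rewrite size_filter -has_count has_predC.
    by apply: contra nconst => /all_pred1_constant.
  - by case/orP: cv => [|/andP[_]] ->; rewrite ?orbT.
have {small} cl v : (count_mem v l <= 2)%N /\ (v = 0 -> (count_mem v l <= 1)%N).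
  have [vl|/count_memPn -> //] := boolP (v \in l).
  move/hasPn: small => /(_ v vl); rewrite negb_or negb_and -leqNgt => /andP[-> /orP[]].
    by rewrite -leqNgt.
  by move=> /eqP v0; split.
have l5 : (5 <= size l)%N by rewrite sl.
have [x [y [z [s [pl xy xz yz]]]]] := pick3 l5 (fun v => (cl v).1).
have [/hasP [v vl /eqP cv]|] := boolP (has (fun v => count_mem v l == 1%N) l).
  (* Among three distinct values two have different squares, since equal squares would force
     [y = z = - x]. *)
  have [a [b [s' [pab ab]]]] : exists a b s', perm_eq l [:: a, b & s'] /\
      a ^+ 2 != b ^+ 2.
    have [sqxy|] := eqVneq (x ^+ 2) (y ^+ 2); last by exists x, y, (z :: s).
    exists x, z, (y :: s); split.
      apply: perm_trans pl _; rewrite perm_cons.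
      by rewrite (perm_catCA [:: y] [:: z]).
    apply/negP => /eqP sqxz.
    have xy' : x + y = 0.
      apply/eqP; have /eqP : (x - y) * (x + y) = 0 by rewrite -subr_sqr sqxy subrr.
      by rewrite mulf_eq0 subr_eq0 (negbTE xy).
    have xz' : x + z = 0.
      apply/eqP; have /eqP : (x - z) * (x + z) = 0 by rewrite -subr_sqr sqxz subrr.
      by rewrite mulf_eq0 subr_eq0 (negbTE xz).
    by case/eqP: yz; apply: (addrI x); rewrite xy' xz'.
  have ss' : (3 <= size s')%N by have := perm_size pab; rewrite /= sl => -[<-].
  case: s' ss' pab => [//|i s'] /= ss' pab.
  (* Besides [a] and [b] at least three entries remain, and [i] occurs at most twice. *)
  have /allPn [j js /= ji] : ~~ all (pred1 i) s'.
    apply/negP => /all_pred1P E; have := (cl i).1.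
    rewrite (seq.permP pab) /= E count_nseq /= !eqxx.
    move: ss' (nat_of_bool (a == i)) (nat_of_bool (b == i)); move: (size s').
    by clear; lia.
  have /perm_to_rem := js.
  have : (0 < size (rem j s'))%N.
    by rewrite size_rem //; case: (size s') ss' => [|[]].
  case: (rem j s') => [//|w t] _ pj.
  have perm5 u1 u2 : perm_eq [:: u1; u2] [:: i; j] ->
      perm_eq [:: u1, a, w, b, u2 & t] l.
    move=> pu; rewrite perm_sym; apply: perm_trans pab _.
    apply/seq.permP => P; rewrite /= (seq.permP pj) /=.
    have := seq.permP pu P; rewrite /=.
    move: (nat_of_bool (P u1)) (nat_of_bool (P u2)) (nat_of_bool (P i))
      (nat_of_bool (P j)) (nat_of_bool (P a)) (nat_of_bool (P b))
      (nat_of_bool (P w)) (count P t).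
    by clear; lia.
  have hank : (hankel i a w b j != 0) || (hankel j a w b i != 0).
    rewrite -negb_and; apply/negP => /andP[/eqP h1 /eqP h2].
    have := hankel_swap i a w b j; rewrite h1 h2 subrr => /esym/eqP.
    by rewrite mulf_eq0 !subr_eq0 (negbTE ab) orbF eq_sym; apply/negP.
  case/orP: hank => hank.
    have p5 := perm5 i j (perm_refl _); exists [:: i, a, w, b, j & t]; split=> //.
    apply: (arrangement_hankel erefl _ hank (v := v)).
      by rewrite (perm_size p5).
    by rewrite (seq.permP p5).
  have p5 := perm5 j i (permEl (perm_catC [:: j] [:: i])).
  exists [:: j, a, w, b, i & t]; split=> //.
  apply: (arrangement_hankel erefl _ hank (v := v)).
    by rewrite (perm_size p5).
  by rewrite (seq.permP p5).
move/hasPn => c1.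
have c2 v : v \in l -> count_mem v l = 2%N /\ v != 0.
  move=> vl; have := c1 v vl; have [h1 h2] := cl v.
  have : (0 < count_mem v l)%N by rewrite -has_count has_pred1.
  by split; [lia | apply/eqP => /h2; lia].
have xl : x \in l by rewrite (perm_mem pl) inE eqxx.
have yl : y \in l by rewrite (perm_mem pl) !inE eqxx orbT.
have zl : z \in l by rewrite (perm_mem pl) !inE eqxx !orbT.
have px := perm_eq_block x l; rewrite (c2 x xl).1 in px.
set l1 := [seq u <- l | u != x] in px.
have py := perm_eq_block y l1.
have cy : count_mem y l1 = 2%N.
  by have := (c2 y yl).1; rewrite (seq.permP px) /= (negbTE xy).
rewrite cy in py; set l2 := [seq u <- l1 | u != y] in py.
have pz := perm_eq_block z l2.
have cz : count_mem z l2 = 2%N.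
  have := (c2 z zl).1.
  by rewrite (seq.permP px) /= (seq.permP py) /= (negbTE xz) (negbTE yz).
rewrite cz in pz; set l3 := [seq u <- l2 | u != z] in pz.
have p6 : perm_eq ([:: x; x; z; y; y; z] ++ l3) l.
  apply/seq.permP => P; rewrite (seq.permP px) /= (seq.permP py) /= (seq.permP pz) /=.
  move: (nat_of_bool (P x)) (nat_of_bool (P y)) (nat_of_bool (P z)) (count P l3).
  by clear; lia.
exists ([:: x; x; z; y; y; z] ++ l3); split=> //.
apply: (arrangement_pairs erefl) => //; first by rewrite (perm_size p6).
- by rewrite !mem_filter eqxx !andbF.
- exact: (c2 z zl).2.
Qed.

Lemma aperiodic_permutation_exists d : (exists i j, d i != d j) ->
  exists p : {perm 'I_n}, aperiodic (fun i => d (p i)) /\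
    no_recurrence2 (fun i => d (p i)).
Proof.
move=> [i [j dij]].
have [||l [/tuple_permP [p pE] [ok1 ok2]]] := @arrangement_exists [tuple d i | i < n].
- by rewrite size_tuple.
- apply: contra dij => /(constantP 0) [x lE].
  have lx u : d u = x.
    have : d u \in tval [tuple d i | i < n].
      by apply/tnthP; exists u; rewrite tnth_mktuple.
    by rewrite lE mem_nseq => /andP[_ /eqP].
  by rewrite !lx.
exists p; have lE (u : 'I_n) : l`_u = d (p u).
  by rewrite pE -(tnth_nth 0 [tuple tnth [tuple d i | i < n] (p i) | i < n] u) !tnth_mktuple.
split=> [q H|al be ga H]; first by apply: ok1 => u; rewrite !lE.
by apply: ok2 => u; rewrite !lE.
Qed.

End Arrangement.

(** * Evaluations on matrix units *)

Section Word.
Variables (K : fieldType) (n m : nat).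
Local Notation X := {ffun 'I_m -> 'M[K]_n}.
Implicit Types (a : X) (l : seq 'I_m).

Definition word l (a : 'I_m -> 'M[K]_n) : 'M[K]_n :=
  foldr (fun i acc => a i *m acc) 1%:M l.

Lemma word_upd_notin l a i x : i \notin l -> word l (upd a i x) = word l a.
Proof.
elim: l => //= j l IH; rewrite inE negb_or => /andP[ij il].
by rewrite IH // ffunE eq_sym (negbTE ij).
Qed.

Lemma word_linear l a i k x y : uniq l -> i \in l ->
  word l (upd a i (k *: x + y)) = k *: word l (upd a i x) + word l (upd a i y).
Proof.
elim: l => //= j l IH /andP[jl ul]; rewrite inE; have [->|ij] /= := eqVneq i j.
  by move=> _; rewrite !word_upd_notin // !ffunE eqxx mulmxDl -scalemxAl.
by move=> il; rewrite IH // !ffunE eq_sym (negbTE ij) mulmxDr -scalemxAr.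
Qed.

(** Leibniz rule for the inner derivation by [b]. *)
Lemma word_derivation l a b : uniq l ->
  \sum_(i <- l) word l (upd a i (b *m a i - a i *m b)) = b *m word l a - word l a *m b.
Proof.
elim: l => [|j l IH] /=; first by rewrite big_nil mulmx1 mul1mx subrr.
move=> /andP[jl ul]; rewrite big_cons /= word_upd_notin // ffunE eqxx.
have -> : \sum_(i <- l) upd a i (b *m a i - a i *m b) j *m
      word l (upd a i (b *m a i - a i *m b)) =
    a j *m \sum_(i <- l) word l (upd a i (b *m a i - a i *m b)).
  rewrite mulmx_sumr; apply: eq_big_seq => i il.
  by rewrite ffunE; case: eqP jl => // ->; rewrite il.
by rewrite IH // mulmxBl mulmxBr !mulmxA addrA subrK.
Qed.

(** Conjugation by a permutation matrix. *)
Definition relabel (p : {perm 'I_n}) (A : 'M[K]_n) : 'M[K]_n :=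
  \matrix_(i, j) A (p i) (p j).

Lemma relabelM p A B : relabel p (A *m B) = relabel p A *m relabel p B.
Proof.
apply/matrixP => i j; rewrite !mxE (reindex_perm p) /=.
by apply: eq_bigr => k _; rewrite !mxE.
Qed.

Lemma relabel_delta p i j : relabel p (delta_mx i j) = delta_mx (p^-1 i)%g (p^-1 j)%g.
Proof.
by apply/matrixP => r s; rewrite !mxE !(canF_eq (permK p)).
Qed.

Lemma word_relabel l p a : word l (fun i => relabel p (a i)) = relabel p (word l a).
Proof.
elim: l => /= [|i l ->]; last by rewrite relabelM.
by apply/matrixP => i j; rewrite !mxE (inj_eq perm_inj).
Qed.

(** The elementary grading in which [e_ij] has degree [h j - h i]; the zero matrix has every
    degree. *)
Definition homogeneous (G : zmodType) (h : 'I_n -> G) (g : G) (A : 'M[K]_n) : Prop :=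
  forall i j, A i j != 0 -> h j - h i = g.

Lemma homogeneous_word (G : zmodType) (h : 'I_n -> G) (g : 'I_m -> G) l a :
  (forall k, homogeneous h (g k) (a k)) ->
  homogeneous h (\sum_(k <- l) g k) (word l a).
Proof.
move=> ha; elim: l => /= [|k l IH] i j.
  by rewrite big_nil mxE; have [->|] := eqVneq i j; rewrite ?subrr ?eqxx.
rewrite mxE big_cons => nz.
have [t] : exists t, a k i t * word l a t j != 0.
  apply/existsP; apply: contraNT nz; rewrite negb_exists => /forallP z.
  by rewrite big1 // => t _; apply/eqP; have := z t; rewrite negbK.
rewrite mulf_eq0 negb_or => /andP[/ha <- /IH <-].
by rewrite [RHS]addrC addrA subrK.
Qed.

End Word.

(** * Multilinear polynomials on matrices *)

Section Mlin.
Variables (K : fieldType) (n m : nat) (c : {perm 'I_m} -> K).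
Local Notation X := {ffun 'I_m -> 'M[K]_n}.
Let f (a : X) : 'M[K]_n := mlin_eval c a.

Lemma mlin_eval_word (a : 'I_m -> 'M[K]_n) :
  mlin_eval c a = \sum_(s : {perm 'I_m}) c s *: word [seq s i | i <- enum 'I_m] a.
Proof. by apply: eq_bigr => s _; rewrite /word [in RHS](foldr_map s). Qed.

Lemma perm_enum_map (s : {perm 'I_m}) :
  perm_eq [seq s i | i <- enum 'I_m] (index_enum 'I_m).
Proof.
apply: uniq_perm; rewrite ?index_enum_uniq ?(map_inj_uniq perm_inj) ?enum_uniq //.
move=> i; rewrite mem_index_enum; apply/mapP.
by exists (s^-1 i)%g; rewrite ?mem_enum // permKV.
Qed.

Lemma mlin_multilinear : multilinear_map f.
Proof.
move=> a i k x y; rewrite /f !mlin_eval_word scaler_sumr -big_split /=.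
apply: eq_bigr => s _; rewrite word_linear ?scalerDr ?scalerA 1?mulrC //.
  by rewrite (perm_uniq (perm_enum_map s)) index_enum_uniq.
by rewrite (perm_mem (perm_enum_map s)) mem_index_enum.
Qed.

(** By the Leibniz rule in each monomial, the tangent space contains every commutator with the value
    [f a]. *)
Lemma mlin_derivation a b :
  tangent f a [ffun i => b *m a i - a i *m b] = b *m f a - f a *m b.
Proof.
rewrite /tangent /f mlin_eval_word mulmx_sumr mulmx_suml -sumrB.
under eq_bigr => i _ do rewrite mlin_eval_word.
rewrite exchange_big; apply: eq_bigr => s _ /=.
rewrite -scaler_sumr -scalemxAr -scalemxAl -scalerBr; congr (_ *: _).
rewrite -word_derivation; last by rewrite (perm_uniq (perm_enum_map s)) index_enum_uniq.
by rewrite (perm_big _ (perm_enum_map s)); apply: eq_bigr => i _; rewrite ffunE.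
Qed.

Lemma mlin_relabel p (a : X) : f [ffun i => relabel p (a i)] = relabel p (f a).
Proof.
rewrite /f !mlin_eval_word; apply/matrixP => i j; rewrite mxE !summxE.
apply: eq_bigr => s _; rewrite !mxE; congr (_ * _).
have -> : word [seq s i | i <- enum 'I_m] [ffun i => relabel p (a i)] =
    word [seq s i | i <- enum 'I_m] (fun i => relabel p (a i)).
  by elim: (map s _) => //= k l ->; rewrite ffunE.
by rewrite word_relabel mxE.
Qed.

(** Each monomial contains every variable exactly once, so all monomials have the same degree. *)
Lemma mlin_homogeneous (G : zmodType) (h : 'I_n -> G) (g : 'I_m -> G) (a : X) :
  (forall k, homogeneous h (g k) (a k)) -> homogeneous h (\sum_k g k) (f a).
Proof.
move=> ha i j; rewrite /f mlin_eval_word summxE => nz.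
have [s] : exists s : {perm 'I_m}, word [seq s i | i <- enum 'I_m] a i j != 0.
  apply/existsP; apply: contraNT nz; rewrite negb_exists => /forallP z.
  by rewrite big1 // => s _; have := z s; rewrite negbK mxE => /eqP ->; rewrite mulr0.
by move/(homogeneous_word ha) ->; apply: perm_big; apply: perm_enum_map.
Qed.

Definition units (u : {ffun 'I_m -> 'I_n * 'I_n}) : X :=
  [ffun k => delta_mx (u k).1 (u k).2].

Lemma homogeneous_units (G : zmodType) (h : 'I_n -> G)
    (u : {ffun 'I_m -> 'I_n * 'I_n}) :
  homogeneous h (\sum_k (h (u k).2 - h (u k).1)) (f (units u)).
Proof.
apply: mlin_homogeneous => k i j; rewrite ffunE mxE.
by case: andP => [[/eqP -> /eqP ->]|]; rewrite ?eqxx.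
Qed.

End Mlin.

Lemma partial_linear (K : fieldType) (m : nat) (V W : lmodType K)
    (f : {ffun 'I_m -> V} -> W) a i :
  multilinear_map f -> exists T : {linear V -> W}, T =1 fun x => f (upd a i x).
Proof.
move=> fml; have Tlin : linear (fun x => f (upd a i x)) by move=> k x y; apply: fml.
pose T0 := GRing.isLinear.Build K V W *:%R (fun x => f (upd a i x)) Tlin.
by exists (HB.pack_for {linear V -> W} (fun x => f (upd a i x)) T0).
Qed.

Lemma multilinear_units_ind (K : fieldType) (n m : nat) (W : lmodType K)
    (f : {ffun 'I_m -> 'M[K]_n} -> W) (Q : W -> Prop) :
  multilinear_map f -> Q 0 -> (forall k x y, Q x -> Q y -> Q (k *: x + y)) ->
  (forall u, Q (f (units K u))) -> forall a, Q (f a).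
Proof.
move=> fml Q0 QD Qu a.
have Qsum (I : Type) (r : seq I) (F : I -> W) :
    (forall i, Q (F i)) -> Q (\sum_(i <- r) F i).
  move=> QF; elim: r => [|i r IH]; first by rewrite big_nil.
  by rewrite big_cons -[F i]scale1r; apply: QD.
have gen (S : seq 'I_m) : forall a : {ffun 'I_m -> 'M[K]_n}, (forall j, j \notin S ->
    exists u : 'I_n * 'I_n, a j = delta_mx u.1 u.2) -> Q (f a).
  elim: S => [|i S IH] {}a aP.
    have H j : exists u : 'I_n * 'I_n, a j = delta_mx u.1 u.2 by apply: aP.
    have [u uP] := fin_all_exists H.
    have -> : a = units K [ffun j => u j] by apply/ffunP => j; rewrite !ffunE uP.
    exact: Qu.
  rewrite -(upd_id a i); have [T TE] := partial_linear a i fml.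
  rewrite -TE [a i]matrix_sum_delta linear_sum; apply: (Qsum) => r.
  rewrite linear_sum; apply: (Qsum) => s; rewrite linearZ -[X in Q X]addr0; apply: QD => //.
  rewrite TE; apply: IH => j jS; rewrite ffunE.
  have [_|ji] := eqVneq j i; first by exists (r, s).
  by apply: aP; rewrite inE negb_or ji.
by apply: (gen (enum 'I_m)) => j; rewrite mem_enum.
Qed.

(** By multilinearity some value on units is nonscalar. If it is not diagonal, a commutator makes it
    diagonal and still nonscalar; the Leibniz rule writes this commutator through values on units of
    weight zero, one of which is nonscalar. *)
Lemma nonscalar_diagonal_units (K : fieldType) (n m : nat) (c : {perm 'I_m} -> K) :
  (3 <= n)%N -> ~ @is_PI K n m c -> ~ @is_central K n m c ->
  exists u (D : 'rV[K]_n), mlin_eval c (units K u) = diag_mx D /\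
    exists i j, D 0 i != D 0 j.
Proof.
move=> n3 nPI ncent; pose f (a : {ffun 'I_m -> 'M[K]_n}) := mlin_eval c a.
pose scal (A : 'M[K]_n) := exists k : K, A = k%:M.
have scal0 : scal 0 by exists 0; rewrite raddf0.
have scalD k x y : scal x -> scal y -> scal (k *: x + y).
  by move=> [s ->] [t ->]; exists (k * s + t); rewrite scale_scalar_mx -raddfD.
have fml : multilinear_map f := @mlin_multilinear K n m c.
have [u nu] : exists u, ~ scal (f (units K u)).
  apply: NNPP => nex; apply: ncent; split=> // a.
  have -> : mlin_eval c a = f [ffun i => a i].
    by rewrite /f; congr mlin_eval; apply: functional_extensionality => i; rewrite ffunE.
  apply: (multilinear_units_ind (Q := scal) fml) => // u.
  by apply: NNPP => nu; apply: nex; exists u.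
(* Weights in [Z^n]: a value of nonzero weight [h j - h i] is a multiple of
   [e_ij], and the derivation by [e_ji] moves it to the diagonal. *)
pose h (i : 'I_n) : {ffun 'I_n -> int} := [ffun j => (i == j)%:R].
have hinj : injective h.
  move=> i j /ffunP /(_ j); rewrite !ffunE eqxx.
  by have [->|] := eqVneq i j.
pose wt (u : {ffun 'I_m -> 'I_n * 'I_n}) := \sum_(k < m) (h (u k).2 - h (u k).1).
have diagonal (u' : {ffun 'I_m -> 'I_n * 'I_n}) : wt u' = 0 -> ~ scal (f (units K u')) ->
    exists (D : 'rV[K]_n), f (units K u') = diag_mx D /\ exists i j, D 0 i != D 0 j.
  move=> w0 nscal; exists (\row_i f (units K u') i i).
  have fE : f (units K u') = diag_mx (\row_i f (units K u') i i).
    apply/matrixP => i j; rewrite !mxE; have [->|ij] := eqVneq i j; first by rewrite mulr1n.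
    rewrite mulr0n; apply/eqP/negPn/negP => /(homogeneous_units h).
    rewrite -/(wt u') w0 => /eqP; rewrite subr_eq0 => /eqP /hinj ji.
    by rewrite ji eqxx in ij.
  split=> //; apply: NNPP => nex; apply: nscal.
  have n0 : (0 < n)%N by lia.
  exists (f (units K u') (Ordinal n0) (Ordinal n0)); rewrite {1}fE.
  apply/matrixP => i j; rewrite !mxE; congr (_ *+ _).
  apply/eqP/negPn/negP => ne; apply: nex; exists i, (Ordinal n0).
  by rewrite !mxE.
have [w0|w0] := eqVneq (wt u) 0.
  by have [D DP] := diagonal u w0 nu; exists u, D.
have hom : homogeneous h (wt u) (f (units K u)) := @homogeneous_units K n m c _ h u.
have [i [j Mij]] : exists i j, f (units K u) i j != 0.
  apply: NNPP => nex; apply: nu; exists 0; rewrite raddf0.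
  apply/matrixP => i j; rewrite mxE; apply/eqP/negPn/negP => ne.
  by apply: nex; exists i, j.
have wE := hom _ _ Mij.
have ij : i != j by apply: contraNneq w0 => ij; rewrite -wE ij subrr.
(* The commutator has diagonal entry [0] at the third index [l] and a nonzero one at [j], so it is
   not scalar. *)
have [l li lj] : exists2 l : 'I_n, l != i & l != j.
  have /set0Pn [l] : ~: [set i; j] != set0.
    rewrite -cards_eq0 -lt0n; have := cardsC [set i; j].
    by rewrite cards2 ij card_ord; lia.
  by rewrite !inE negb_or => /andP[li lj]; exists l.
have hd (r : 'I_n) : f (units K u) r r = 0.
  by apply/eqP; apply: contraNT w0 => /hom <-; rewrite subrr.
pose e : 'M[K]_n := delta_mx j i.
have e1 (A : 'M[K]_n) r s : (e *m A) r s = (r == j)%:R * A i s.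
  rewrite mxE (bigD1 i) //= mxE eqxx andbT big1 ?addr0 // => t ti.
  by rewrite mxE (negbTE ti) andbF mul0r.
have e2 (A : 'M[K]_n) r s : (A *m e) r s = A r j * (s == i)%:R.
  rewrite mxE (bigD1 j) //= mxE eqxx big1 ?addr0 // => t tj.
  by rewrite mxE (negbTE tj) mulr0.
have dE r t : (e *m f (units K u) - f (units K u) *m e) r t =
    (r == j)%:R * f (units K u) i t - f (units K u) r j * (t == i)%:R.
  by rewrite [LHS]mxE [X in _ + X]mxE e1 e2.
have ncomm : ~ scal (e *m f (units K u) - f (units K u) *m e).
  move=> [s /matrixP sE]; have := sE j j; have := sE l l.
  rewrite !dE ![s%:M _ _]mxE !eqxx (negbTE li) (negbTE lj) eq_sym (negbTE ij).
  rewrite mul0r !mulr0 subrr mul1r subr0 !mulr1n => <- fij.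
  by rewrite fij eqxx in Mij.
have [k nk] : exists k, ~ scal (f (upd (units K u) k (e *m units K u k - units K u k *m e))).
  apply: NNPP => nex; apply: ncomm; rewrite -(mlin_derivation c) /tangent.
  elim: (index_enum _) => [|k s IH]; first by rewrite big_nil.
  rewrite big_cons -[X in X + _]scale1r; apply: scalD => //.
  by rewrite ffunE; apply: NNPP => nk; apply: nex; exists k.
pose u2 r s : {ffun 'I_m -> 'I_n * 'I_n} := [ffun t => if t == k then (r, s) else u t].
have u2E r s : units K (u2 r s) = upd (units K u) k (delta_mx r s).
  by apply/ffunP => t; rewrite !ffunE; case: eqP.
(* The new unit in slot [k] has its degree lowered by [h j - h i], which is the whole weight of
   [u]. *)
have wt2 r s : h s - h r = h (u k).2 - h (u k).1 - (h j - h i) -> wt (u2 r s) = 0.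
  have wtD : wt u = h (u k).2 - h (u k).1 + \sum_(t | t != k) (h (u t).2 - h (u t).1).
    by rewrite /wt (bigD1 k).
  move=> rs; rewrite /wt (bigD1 k) //= ffunE eqxx /= rs addrAC.
  rewrite (eq_bigr (fun t => h (u t).2 - h (u t).1)) => [|t /negbTE tk].
    by rewrite -wtD wE subrr.
  by rewrite ffunE tk.
suff [r [s [rs nrs]]] : exists r s, h s - h r = h (u k).2 - h (u k).1 - (h j - h i)
    /\ ~ scal (f (units K (u2 r s))).
  by have [D DP] := diagonal _ (wt2 _ _ rs) nrs; exists (u2 r s), D.
have [T TE] := partial_linear (units K u) k fml.
apply: NNPP => nex; apply: nk; rewrite -TE linearB.
have eE : e *m units K u k = ((u k).1 == i)%:R *: delta_mx j (u k).2.
  apply/matrixP => r s; rewrite e1 !mxE ffunE mxE [i == _]eq_sym.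
  by case: (r == j); case: (_ == i); case: (s == _); rewrite ?(mul0r, mulr0, mul1r).
have eE' : units K u k *m e = ((u k).2 == j)%:R *: delta_mx (u k).1 i.
  apply/matrixP => r s; rewrite e2 !mxE ffunE mxE [j == _]eq_sym.
  by case: (s == i); case: (_ == j); case: (r == _); rewrite ?(mul0r, mulr0, mulr1).
rewrite -[X in _ - X]scale1r -scaleNr addrC; apply: scalD.
  rewrite eE' linearZZ; case: eqP => [ukj|_]; last by rewrite scale0r.
  rewrite scale1r TE -u2E; apply: NNPP => ns; apply: nex.
  by exists (u k).1, i; split=> //; rewrite ukj opprB [RHS]addrC addrA subrK.
rewrite eE linearZZ; case: eqP => [uki|_]; last by rewrite scale0r.
rewrite scale1r TE -u2E; apply: NNPP => ns; apply: nex.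
by exists j, (u k).2; split=> //; rewrite uki opprB addrA subrK.
Qed.

(** * The cyclic grading *)

Section CyclicGrading.
Variables (K : fieldType) (k m : nat) (c : {perm 'I_m} -> K).
Hypothesis Kinf : infinite_type K.
Local Notation n := (k.+4.+1).
Local Notation X := {ffun 'I_m -> 'M[K]_n}.
Let f (a : X) : 'M[K]_n := mlin_eval c a.
Let fml : multilinear_map f := @mlin_multilinear K n m c.

Definition graded_part (g : 'I_n) (A : 'M[K]_n) : 'M[K]_n :=
  \matrix_(i, j) if j - i == g then A i j else 0.

Lemma graded_partD g x A B :
  graded_part g (x *: A + B) = x *: graded_part g A + graded_part g B.
Proof.
by apply/matrixP => i j; rewrite !mxE; case: ifP => _; rewrite ?mulr0 ?addr0.
Qed.

Variables (g : 'I_m -> 'I_n) (sum_g : \sum_i g i = 0).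

Definition graded_point (a : X) : X := [ffun i => graded_part (g i) (a i)].

Lemma graded_point_upd a i x :
  graded_point (upd a i x) = upd (graded_point a) i (graded_part (g i) x).
Proof. by apply/ffunP => j; rewrite !ffunE; case: eqP => [->|]. Qed.

Definition graded_diag (a : X) : 'rV[K]_n := \row_i f (graded_point a) i i.

Lemma graded_diagE a : f (graded_point a) = diag_mx (graded_diag a).
Proof.
apply/matrixP => i j; rewrite !mxE; have [->|ij] := eqVneq i j; first by rewrite mulr1n.
rewrite mulr0n; apply/eqP/negPn/negP => nz.
have /(_ _ _ nz)/eqP : homogeneous id (\sum_i g i) (f (graded_point a)).
  apply: mlin_homogeneous => l r s; rewrite ffunE mxE.
  by case: ifP => [/eqP //|_]; rewrite eqxx.
by rewrite sum_g subr_eq0 eq_sym (negbTE ij).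
Qed.

Lemma graded_diag_multilinear : multilinear_map graded_diag.
Proof.
move=> a i x A B; apply/rowP => j.
by rewrite !mxE !graded_point_upd graded_partD fml !mxE.
Qed.

(** The commutator of [e_ij] with a diagonal value is [e_ij] times a difference of diagonal entries;
    moving one slot inside its graded component produces the diagonal partial values. *)
Lemma zdim_ge_graded (a : X) (p : 'I_3 -> 'I_m * 'M[K]_n) :
  row_free (partials graded_diag p a) ->
  (forall i j, i != j -> graded_diag a 0 i != graded_diag a 0 j) ->
  zdim_ge (zclosure (fun A => exists x, A = f x)) (n * n - n + 3).
Proof.
move=> pfree dist; set a' := graded_point a.
have [T TE] := tangent_linear a' fml.
pose U := limg (linfun T).
have UT b : tangent f a' b \in U.
  by rewrite -TE -(lfunE T) memv_img ?memvf.
apply: (zdim_ge_tangent (U := U) (a := a') Kinf fml).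
  by move=> A /memv_imgP [b _ ->]; exists b; rewrite lfunE /= TE.
apply: (dim_offdiag_diag (M := partials graded_diag p a)) pfree _ => [i j ij|l].
  pose e : 'M[K]_n := delta_mx i j.
  have : tangent f a' [ffun l => e *m a' l - a' l *m e] \in U by apply: UT.
  rewrite (mlin_derivation c) -/(f a') graded_diagE.
  have -> : e *m diag_mx (graded_diag a) - diag_mx (graded_diag a) *m e =
      (graded_diag a 0 j - graded_diag a 0 i) *: e.
    apply/matrixP => r s; rewrite mul_mx_diag mul_diag_mx !mxE.
    case: (eqVneq r i) => [->|_]; case: (eqVneq s j) => [->|_] /=;
      by rewrite ?(mul1r, mul0r, mulr1, mulr0, subrr).
  by rewrite rpredZeq subr_eq0 (negbTE (dist _ _ _)) // eq_sym.
have -> : diag_mx (row l (partials graded_diag p a)) =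
    tangent f a' [ffun t => if t == (p l).1 then graded_part (g (p l).1) (p l).2 else 0].
  rewrite rowK -graded_diagE graded_point_upd /tangent (bigD1 (p l).1) //=.
  rewrite ffunE eqxx big1 ?addr0 // => t /negbTE tl.
  rewrite ffunE tl; have [S SE] := partial_linear a' t fml.
  by rewrite -SE linear0.
exact: UT.
Qed.

End CyclicGrading.

(** * The bound for a multilinear polynomial *)

Lemma zdim_ge_mlin (K : fieldType) (k m : nat) (c : {perm 'I_m} -> K) :
  let n := k.+4.+1 in
  infinite_type K -> ~ @is_PI K n m c -> ~ @is_central K n m c ->
  zdim_ge (zclosure (fun A => exists x : {ffun 'I_m -> 'M[K]_n}, A = mlin_eval c x))
    (n * n - n + 3).
Proof.
move=> n Kinf nPI ncent.
have [u0 [D [u0E Dne]]] := nonscalar_diagonal_units (isT : (3 <= n)%N) nPI ncent.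
have [s [aper norec]] := aperiodic_permutation_exists Dne.
set d := fun i => D 0 (s i) in aper norec.
have [u uE] : exists u, mlin_eval c (units K u) = diag_mx (\row_i d i).
  exists [ffun t => ((s^-1 (u0 t).1)%g, (s^-1 (u0 t).2)%g)].
  rewrite (_ : units _ _ = [ffun t => relabel s (units K u0 t)]).
    rewrite mlin_relabel u0E; apply/matrixP => i j; rewrite !mxE.
    by rewrite (inj_eq perm_inj).
  by apply/ffunP => t; rewrite !ffunE relabel_delta.
pose g (t : 'I_m) : 'I_n := (u t).2 - (u t).1.
have sum_g : \sum_t g t = 0.
  (* The zero function has period [1], so [d] has a nonzero entry; as a diagonal entry it has degree
     [0], and as part of the value it has degree [\sum_t g t]. *)
  have [i di] : exists i, d i != 0.
    apply: NNPP => nex; have /aper/eqP : forall i, d (i + 1) = d i; last by [].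
    have d0 i : d i = 0 by apply/eqP/negPn/negP => di; apply: nex; exists i.
    by move=> i; rewrite !d0.
  have := @homogeneous_units K n m c _ id u i i.
  by rewrite uE !mxE eqxx subrr => /(_ di).
pose R := graded_diag c g.
have shift q : exists x, R x = \row_i d (i + q).
  (* Translation of the indices preserves the differences [j - i], so the relabelled units stay in
     their graded components. *)
  pose r := perm (addIr q).
  exists [ffun t => relabel r (units K u t)].
  have gE : graded_point g [ffun t => relabel r (units K u t)] =
      [ffun t => relabel r (units K u t)].
    apply/ffunP => t; rewrite !ffunE relabel_delta; apply/matrixP => i j; rewrite !mxE.
    case: andP => [[/eqP iE /eqP jE]|]; last by rewrite if_same.
    rewrite (_ : j - i == g t) // /g -[(u t).2](permKV r) -[(u t).1](permKV r).
    by rewrite -iE -jE !permE opprD addrACA subrr addr0.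
  apply/rowP => i; rewrite !mxE gE mlin_relabel uE !mxE eqxx permE mulr1n.
  by [].
have Rml : multilinear_map R := @graded_diag_multilinear K k m c g.
have [P|p [a0 pfree]] := multilinear_partials3 Kinf Rml.
  apply: NNPP => nex.
  have RP x : (R x <= P)%MS by apply/negPn/negP => H; apply: nex; exists x.
  (* In the three coordinates [0], [1], [2] the two rows of [P] satisfy a common linear equation
     [w]; on the shift by [q] it reads as a recurrence for [d]. *)
  pose ev (r : nat) (A : 'M[K]_(r, n)) : 'M[K]_(r, 3) :=
    \matrix_(i, j) A i (nat_of_ord j)%:R.
  have /rowV0Pn [w /sub_kermxP wP w0] : kermx (ev 2 P)^T != 0.
    rewrite kermx_eq0 /row_free neq_ltn; apply/orP; left.
    exact: leq_ltn_trans (rank_leq_col _) _.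
  have rec q : w 0 0 * d q + w 0 1 * d (q + 1) + w 0 2%:R * d (q + 2%:R) = 0.
    have [x xE] := shift q; have /submxP [y yE] := RP x.
    have : w *m (ev 1%N (R x))^T = 0.
      have -> : ev 1%N (R x) = y *m ev 2 P.
        by apply/matrixP => i j; rewrite yE !mxE; apply: eq_bigr => l _; rewrite !mxE.
      by rewrite trmx_mul mulmxA wP mul0mx.
    move/matrixP/(_ 0 0); rewrite !mxE => wR.
    have sum3 (G : 'I_3 -> K) : \sum_j G j = G 0 + G 1 + G 2%:R.
      rewrite !big_ord_recl big_ord0 addr0 addrA.
      by congr (_ + G _ + G _); apply: val_inj.
    rewrite -[RHS]wR xE sum3 !mxE.
    congr (_ * d _ + _ * d _ + _ * d _); first by rewrite add0r.
      by rewrite [LHS]addrC.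
    by rewrite [LHS]addrC.
  have [w00 w01 w02] := norec _ _ _ rec.
  case/negP: w0; apply/eqP/rowP => j; rewrite mxE.
  by case: j => [[|[|[|j]]] jlt] //; [rewrite -[RHS]w00|rewrite -[RHS]w01|rewrite -[RHS]w02];
    congr (w _ _); apply: val_inj.
have [e [g3 [g3P g30 g3F]]] := row_free_lpoly (lpoly_partials Rml p) pfree.
(* The conditions on a generic point: [g3] keeps the partial values independent, the differences
   keep the diagonal entries distinct, and [1] fills in for equal indices. *)
pose G (o : option ('I_n * 'I_n)) x : K := if o is Some ij then
  (if ij.1 == ij.2 then 1 else R x 0 ij.1 - R x 0 ij.2) else g3 x.
pose degG (o : option ('I_n * 'I_n)) := if o is Some _ then m else e.
have GP o : lpoly (degG o) (G o).
  rewrite /degG /G; case: o => [[i j]|]; last exact: g3P.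
  rewrite /=; have [_|_] := boolP (i == j); first exact: lpoly_const.
  have Rlp l : mlform (fun x => R x 0 l) by move=> a t x A B; rewrite Rml !mxE.
  apply: lpoly_add; first exact: mlform_lpoly.
  apply: (@lpoly_ext _ _ m (fun x => -1 * R x 0 j)); first by move=> x; rewrite mulN1r.
  by apply: lpoly_scale; apply: mlform_lpoly.
have [o _|a aP] := lpoly_prod_neq0 Kinf (r := enum {: option ('I_n * 'I_n)}) GP.
  rewrite /G; case: o => [[i j]|] /=; last by exists a0.
  case: eqVneq => [_|ij]; first by exists 0; apply: oner_neq0.
  (* If entries [i] and [j] agreed on all shifts, [j - i] would be a period of [d]. *)
  apply: NNPP => nex; case/negP: ij; rewrite eq_sym -subr_eq0; apply/eqP/aper => t.
  have [x xE] := shift (t - i).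
  have : R x 0 i = R x 0 j.
    by apply/eqP; rewrite -subr_eq0; apply/negPn/negP => H; apply: nex; exists x.
  by rewrite xE !mxE addrC subrK addrCA => ->.
apply: (zdim_ge_graded Kinf sum_g (a := a) (p := p)).
  by apply: g3F; apply: (aP None); rewrite mem_enum.
move=> i j ij; have := aP (Some (i, j)); rewrite mem_enum /= (negbTE ij) subr_eq0.
exact.
Qed.

Unset Implicit Arguments.

Theorem theorem1p15 (F : fieldType) (K : fieldExtType F) (n : nat) (eps : K)
  (hn : (5 <= n)%N)
  (hinf : forall s : seq F, exists x : F, x \notin s)
  (hchar : forall q : nat, q \in [pchar F] -> ~~ (q %| n)%N)
  (heps : n.-primitive_root eps)
  (hK : <<1%VS; eps>>%VS = fullv)
  (m : nat) (c : {perm 'I_m} -> K)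
  (hPI : ~ @is_PI K n m c) (hcent : ~ @is_central K n m c) :
  zdim_ge (zclosure (@mlin_image K n m c)) (n ^ 2 - n + 3).
Proof.
have Kinf : infinite_type K.
  exact: (infinite_inj (fmorph_inj (in_alg K)) hinf).
clear heps hK; case: n hn hchar hPI hcent => [|[|[|[|[|k]]]]] // _ _ hPI hcent.
have [Z [Zirr Zstep Zsub]] := zdim_ge_mlin Kinf hPI hcent.
rewrite -mulnn; exists Z; split=> // A /Zsub; apply: zclosure_subset.
by move=> _ [x ->]; exists x.
Qed.
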